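(* Let $\mathbf{A}$ and $M$ be positive definite operators in the Hilbert spaces $\mathcal{H}_{\mathbf{A}}$ and $\mathcal{H}_M$, respectively, and let $F:\mathcal{H}_M\to\mathcal{H}_{\mathbf{A}}$ be a bounded operator. If $M$ is bounded and $$\|M\|<\frac{1}{\|\mathbf{A}^{-1}\|},$$ then there is a unique bounded operator $T:\mathcal{H}_M\to\mathcal{H}_{\mathbf{A}}$ such that $$(\mathbf{A}^{1/2}v,\,TM^{-1/2}u)-(v,\,\mathbf{A}^{-1/2}TM^{1/2}u)=(v,Fu)\qquad\text{for all } v\in\mathcal{D}(\mathbf{A}^{1/2}),\ u\in\mathcal{H}_M .$$ This $T$ is given by $(v,Tu)=\tau(v,u)$, where $$\tau(v,u)=-\frac{1}{2\pi}\int_{-\infty}^{\infty}\bigl(\mathbf{A}^{1/2}v,\ (\mathbf{A}-\mathrm{i}\zeta-d)^{-1}F(M-\mathrm{i}\zeta-d)^{-1}M^{1/2}u\bigr)\,d\zeta ,\qquad v\in\mathcal{D}(\mathbf{A}^{1/2}),\ u\in\mathcal{H}_M,$$ and $d$ is any number satisfying $\|M\|<d<1/\|\mathbf{A}^{-1}\|$.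
   Context: $\mathcal{H}_{\mathbf{A}}$ and $\mathcal{H}_M$ are closed subspaces (possibly different) of an environment complex Hilbert space $\mathcal{H}$ with inner product $(\cdot,\cdot)$ and norm $\|\cdot\|$; $\|\cdot\|$ also denotes the operator norm. A positive definite operator is a (possibly unbounded) selfadjoint operator bounded below by a positive constant, so it has a bounded inverse; $\mathbf{A}$ may be unbounded. $\mathcal{D}(\cdot)$ denotes the domain. *)

(* Defs.v *)
From HB Require Import structures.
From mathcomp Require Import all_boot all_order all_algebra.
From mathcomp Require Import complex.
From mathcomp Require Import all_classical all_reals all_analysis.

Set Implicit Arguments.
Unset Strict Implicit.
Unset Printing Implicit Defensive.

Import Order.TTheory GRing.Theory Num.Theory.
Import numFieldNormedType.Exports.

Local Open Scope classical_set_scope.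
Local Open Scope ring_scope.
Local Open Scope complex_scope.

(* A possibly unbounded operator: [opfun A] is meaningful only on [opdom A]
   (its values elsewhere are junk), so operators are compared with [opeq]. *)
Record operator (H : Type) := Operator { opdom : set H; opfun :> H -> H }.

HB.instance Definition _ (H : Type) := gen_eqMixin (operator H).
HB.instance Definition _ (H : Type) := gen_choiceMixin (operator H).

Section Operators.
Variables (R : realType) (H : completeNormedModType R[i]).
Implicit Types (A B T : operator H) (V W : set H).

Definition opeq A B : Prop :=
  opdom A = opdom B /\ forall x, opdom A x -> A x = B x.

Definition opcomp B A : operator H :=
  Operator [set x | opdom A x /\ opdom B (A x)] (fun x => B (A x)).

(* The inverse of an injective operator, with domain the range of A. *)
Definition opinv A : operator H :=
  Operator [set A x | x in opdom A]
    (fun y => xget 0 [set x | opdom A x /\ A x = y]).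

Definition resolvent A (z : R[i]) : operator H :=
  opinv (Operator (opdom A) (fun x => A x - z *: x)).

(* +oo exactly when A is unbounded. *)
Definition opnorm A : \bar R :=
  ereal_sup [set (complex.Re `|A x|)%:E | x in [set x | opdom A x /\ `|x| <= 1]].

Definition closed_subspace V : Prop := closed V /\ submod_closed [in V].

Definition linear_operator A : Prop :=
  submod_closed [in opdom A] /\
  forall (a : R[i]) x y, opdom A x -> opdom A y ->
    A (a *: x + y) = a *: A x + A y.

Definition bounded_operator V W T : Prop :=
  [/\ linear_operator T, opdom T = V, (forall x, V x -> W (T x)) &
      (opnorm T < +oo)%E].

(* The inner product is linear in its first and conjugate-linear in its second
   argument. *)
Variable dot : {dot H for Num.conj}.

Definition hilbert_norm : Prop := forall x : H, `|x| ^+ 2 = dot x x.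

(* The adjoint of a densely defined operator in the subspace V. *)
Definition adjoint V A : operator H :=
  let adj y z := V z /\ forall x, opdom A x -> dot (A x) y = dot x z in
  Operator [set y | V y /\ exists z, adj y z] (fun y => xget 0 [set z | adj y z]).

Definition selfadjoint V A : Prop :=
  [/\ linear_operator A, closure (opdom A) = V,
      (forall x, opdom A x -> V (A x)) & opeq A (adjoint V A)].

Definition positive_definite V A : Prop :=
  selfadjoint V A /\
  exists2 c : R[i], 0 < c &
    forall x, opdom A x -> c * `|x| ^+ 2 <= dot (A x) x.

Definition is_opsqrt V A B : Prop :=
  [/\ selfadjoint V B, (forall x, opdom B x -> 0 <= dot (B x) x) &
      opeq (opcomp B B) A].

(* For positive A such a B exists and is unique as an operator, i.e. up to
   [opeq]; the default value A is irrelevant. *)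
Definition opsqrt V A : operator H := xget A [set B | is_opsqrt V A B].

End Operators.

Section ComplexIntegral.
Variable R : realType.
Implicit Type f : R -> R[i].

Definition cintegrable f : Prop :=
  (@lebesgue_measure R).-integrable setT (fun t => (complex.Re (f t))%:E) /\
  (@lebesgue_measure R).-integrable setT (fun t => (complex.Im (f t))%:E).

Definition cintegral f : R[i] :=
  Rintegral (@lebesgue_measure R) setT (fun t => complex.Re (f t)) +i*
  Rintegral (@lebesgue_measure R) setT (fun t => complex.Im (f t)).

End ComplexIntegral.

Section Sylvester.
Variables (R : realType) (H : completeNormedModType R[i]).
Variables (dot : {dot H for Num.conj}) (HA HM : set H) (A M F : operator H).

Definition weak_sylvester (T : operator H) : Prop :=
  let sA := opsqrt dot HA A in
  let sM := opsqrt dot HM M in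
  forall v u, opdom sA v -> HM u ->
    dot (sA v) (T (opinv sM u)) - dot v (opinv sA (T (sM u))) = dot v (F u).

Definition tau_integrand (d : R) (v u : H) (zeta : R) : R[i] :=
  dot (opsqrt dot HA A v)
    (resolvent A (d +i* zeta)
      (F (resolvent M (d +i* zeta) (opsqrt dot HM M u)))).

Definition tau (d : R) (v u : H) : R[i] :=
  - ((2 * pi)^-1)%:C * cintegral (tau_integrand d v u).

End Sylvester.

(* Main.v *)
Require Import Defs.
From HB Require Import structures.
From mathcomp Require Import all_boot all_order all_algebra.
From mathcomp Require Import complex.
From mathcomp Require Import all_classical all_reals all_analysis.
From mathcomp Require Import measurable_realfun.
From mathcomp Require Import ring lra.

Set Implicit Arguments.
Unset Strict Implicit.
Unset Printing Implicit Defensive.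

Import Order.TTheory GRing.Theory Num.Theory.
Import numFieldNormedType.Exports.

Local Open Scope classical_set_scope.
Local Open Scope ring_scope.
Local Open Scope complex_scope.

(** The operator [B = A^-1] is bounded, and so are [S = A^-1/2] and [M^1/2].
    Testing the equation with [v = S w] and [u = M^1/2 u0] turns it into
    [T = S F M^1/2 + B T M].  As [|B| |M| < 1], the map [T |-> S F M^1/2 + B T M]
    is a contraction, so there is exactly one bounded solution, the sum of the
    series [B^k S F M^1/2 M^k] ([weak_sylvester_fixpoint], [fixpoint_exists],
    [fixpoint_unique]).

    The square roots exist by a scaled iteration: if [C] is a symmetric
    contraction, the solution [Y] of [2 Y = C + Y^2] is a norm limit, and [1 - Y]
    is a root of [1 - C] ([contraction_sqrt]).  Applied to [1 - C = c A^-1] this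
    gives [A^-1/2], whose inverse is the selfadjoint root of [A]
    ([opsqrt_exists]).  Surjectivity of [A - z] comes from the orthogonal
    projection onto its closed range ([sa_surjective]).

    For the integral formula put [z = d + i t], [r = (M - z)^-1 u] and
    [w = A^1/2 v].  Since [M r = u + z r], the fixed-point equation splits the
    (conjugated) integrand into
    [((T M r, v) - ((A - z)^-1 x0, w)) / z], where [T u = S x0]
    ([resolvent_identity]).  Both terms are [O(1 / |z|^2)], which gives absolute
    integrability, and they are integrated separately.

    The spectrum of [M] lies to the left of the line [Re z = d].  There
    [M (M - z)^-1 / z] is a convergent series in the powers of [1 / z] of order at
    least two, and these integrate to zero
    ([has_cintegral_resolvent_outside]).  The spectrum of [A] lies to the right,
    but is unbounded, so no power series converges on the whole line.  The Moebius
    map [phi = z / (z - 2 e)], with [d < e <= A], sends the line into the open unit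
    disk, and [W = 1 - 2 e B] is a contraction.  From
    [(A - z)^-1 = (1 - phi) B + phi W (A - z)^-1] one gets
    [(A - z)^-1 = (1 - phi) (B + phi W B + phi^2 W^2 B + ...)] with remainders
    bounded by the resolvent itself, so that dominated convergence permits
    termwise integration.  After division by [z] every term but the first is a
    multiple of the derivative of a power of [phi], hence integrates to zero; the
    first is [(1 / z - 1 / (z - 2 e)) B] and contributes [2 pi B]
    ([has_cintegral_moebius], [has_cintegral_poles],
    [has_cintegral_resolvent_inside]).  As [(B x0, w) = (T u, v)], the integral is
    [- 2 pi (T u, v)]. *)

(** * Norms and inner products with real values *)

Section RealNorm.
Variable R : realType.

(** Norms of vectors and scalars take values in [R[i]]; their real part allows
    comparison and limits in the ordered field [R]. *)
Definition nrm (V : normedZmodType R[i]) (x : V) : R := complex.Re `|x|.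

Section NormedGroup.
Variable V : normedZmodType R[i].
Implicit Types x y : V.

Lemma nrmE x : `|x| = (nrm x)%:C.
Proof. by rewrite /nrm RRe_real ?normr_real. Qed.

Lemma nrm_ge0 x : 0 <= nrm x.
Proof. by rewrite -lecR -nrmE; exact: normr_ge0. Qed.

Lemma nrm_eq0 x : nrm x = 0 -> x = 0.
Proof. by move=> x0; apply/eqP; rewrite -normr_eq0 nrmE x0. Qed.

Lemma nrm0 : nrm (0 : V) = 0.
Proof. by rewrite /nrm normr0. Qed.

Lemma nrmN x : nrm (- x) = nrm x.
Proof. by rewrite /nrm normrN. Qed.

Lemma nrmD x y : nrm (x + y) <= nrm x + nrm y.
Proof. by rewrite -lecR rmorphD /= -!nrmE; exact: ler_normD. Qed.

Lemma nrmB x y : nrm (x - y) = nrm (y - x).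
Proof. by rewrite /nrm distrC. Qed.

Lemma nrmBD z x y : nrm (x - y) <= nrm (x - z) + nrm (z - y).
Proof. by have := nrmD (x - z) (z - y); rewrite addrA subrK. Qed.

End NormedGroup.

Lemma nrmM (a b : R[i]) : nrm (a * b) = nrm a * nrm b.
Proof. by apply: complexI; rewrite rmorphM -!nrmE normrM. Qed.

Lemma nrmX (a : R[i]) n : nrm (a ^+ n) = nrm a ^+ n.
Proof. by apply: complexI; rewrite rmorphXn -!nrmE normrX. Qed.

Lemma nrmV (a : R[i]) : nrm a^-1 = (nrm a)^-1.
Proof. by apply: complexI; rewrite fmorphV -!nrmE normfV. Qed.

Lemma nrmZ (V : normedModType R[i]) (a : R[i]) (x : V) :
  nrm (a *: x) = nrm a * nrm x.
Proof. by apply: complexI; rewrite rmorphM /= -!nrmE normrZ. Qed.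

Lemma nrmC (r : R) : nrm r%:C = `|r|.
Proof. by rewrite /nrm normc_def /= expr0n/= addr0 sqrtr_sqr. Qed.

Lemma nrmZ_ge0 (V : normedModType R[i]) (r : R) (x : V) :
  0 <= r -> nrm (r%:C *: x) = r * nrm x.
Proof. by move=> r0; rewrite nrmZ nrmC ger0_norm. Qed.

Lemma nrmJ (a : R[i]) : nrm a^* = nrm a.
Proof. by rewrite /nrm normcJ. Qed.

Lemma nrm_sqr (a : R[i]) : nrm a ^+ 2 = complex.Re a ^+ 2 + complex.Im a ^+ 2.
Proof.
by apply: complexI; rewrite add_Re2_Im2 nrmE rmorphXn.
Qed.

Lemma nrm_Re (a : R[i]) : `|complex.Re a| <= nrm a.
Proof. by rewrite -lecR -nrmE normc_ge_Re. Qed.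

Lemma nrm_Im (a : R[i]) : `|complex.Im a| <= nrm a.
Proof.
rewrite -[leLHS]sqrtr_sqr -[leRHS]ger0_norm ?nrm_ge0// -[leRHS]sqrtr_sqr.
by rewrite ler_sqrt ?sqr_ge0// nrm_sqr lerDr sqr_ge0.
Qed.

Lemma nrm_le_ReIm (a : R[i]) : nrm a <= `|complex.Re a| + `|complex.Im a|.
Proof.
rewrite -(@ler_pXn2r _ 2)// ?nnegrE ?nrm_ge0 ?addr_ge0//.
rewrite nrm_sqr sqrrD !real_normK ?num_real//.
by rewrite addrAC lerDl mulrn_wge0// mulr_ge0.
Qed.

End RealNorm.

Section Hilbert.
Variables (R : realType) (H : completeNormedModType R[i]).
Variable dot : {dot H for Num.conj}.
Implicit Types (x y : H) (V W : set H).

Lemma dotC x y : dot x y = (dot y x)^*.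
Proof. by have := hermC dot x y; rewrite expr0 mul1r. Qed.

Lemma dotDl x y z : dot (x + y) z = dot x z + dot y z.
Proof. exact: linearDl. Qed.
Lemma dotDr x y z : dot z (x + y) = dot z x + dot z y.
Proof. exact: linearDr. Qed.
Lemma dotBl x y z : dot (x - y) z = dot x z - dot y z.
Proof. exact: linearBl. Qed.
Lemma dotBr x y z : dot z (x - y) = dot z x - dot z y.
Proof. exact: linearBr. Qed.
Lemma dotNr x z : dot z (- x) = - dot z x.
Proof. exact: linearNr. Qed.
Lemma dotZl a x z : dot (a *: x) z = a * dot x z.
Proof. exact: linearZl_LR. Qed.
Lemma dotZr (a : R[i]) x z : dot z (a *: x) = a^* * dot z x.
Proof. exact: linearZr_LR. Qed.
Lemma dotZrJ (a : R[i]) x z : dot z (a^* *: x) = a * dot z x.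
Proof. by rewrite dotZr; congr (_ * _); exact: conjcK. Qed.
Lemma dotZr_real (r : R) x z : dot z (r%:C *: x) = r%:C * dot z x.
Proof. by rewrite dotZr; congr (_ * _); exact: conjc_real. Qed.
Lemma dot0l z : dot 0 z = 0.
Proof. exact: linear0l. Qed.
Lemma dot0r z : dot z 0 = 0.
Proof. exact: linear0r. Qed.

Hypothesis dotE : hilbert_norm dot.

Lemma dot_nrm x : dot x x = (nrm x ^+ 2)%:C.
Proof. by rewrite -dotE nrmE rmorphXn. Qed.

Lemma dot_eq0 x : dot x x = 0 -> x = 0.
Proof.
rewrite dot_nrm => /complexI/eqP; rewrite sqrf_eq0 => /eqP; exact: nrm_eq0.
Qed.

Lemma Re_dotC x y : complex.Re (dot x y) = complex.Re (dot y x).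
Proof. by rewrite dotC; case: (dot y x). Qed.

Lemma nrm_sqrB x y :
  nrm (x - y) ^+ 2 = nrm x ^+ 2 + nrm y ^+ 2 - complex.Re (dot x y) *+ 2.
Proof.
apply: complexI; rewrite -dot_nrm dotBl !dotBr !dot_nrm (dotC y x).
case: (dot x y) => a b; apply/eqP; rewrite eq_complex /=.
by apply/andP; split; apply/eqP; ring.
Qed.

Lemma nrm_sqrD x y :
  nrm (x + y) ^+ 2 = nrm x ^+ 2 + nrm y ^+ 2 + complex.Re (dot x y) *+ 2.
Proof.
rewrite -[y in LHS]opprK nrm_sqrB nrmN dotNr.
by case: (dot x y) => a b /=; ring.
Qed.

Lemma parallelogram x y :
  nrm (x + y) ^+ 2 + nrm (x - y) ^+ 2 = (nrm x ^+ 2 + nrm y ^+ 2) *+ 2.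
Proof. by rewrite nrm_sqrD nrm_sqrB; ring. Qed.

Lemma cauchy_schwarz x y : nrm (dot x y) <= nrm x * nrm y.
Proof.
have [->|/eqP y0] := eqVneq y 0; first by rewrite dot0r !nrm0 mulr0.
have y_gt0 : 0 < nrm y.
  by rewrite lt_neqAle nrm_ge0 andbT eq_sym; apply/eqP => /nrm_eq0.
rewrite -(@ler_pXn2r _ 2)// ?nnegrE ?nrm_ge0 ?mulr_ge0 ?nrm_ge0//.
have := sqr_ge0 (nrm ((nrm y ^+ 2)%:C *: x - dot x y *: y)).
rewrite nrm_sqrB !nrmZ dotZl dotZr nrmC ger0_norm ?sqr_ge0//.
have -> : complex.Re ((nrm y ^+ 2)%:C * ((dot x y)^* * dot x y)) =
          nrm y ^+ 2 * nrm (dot x y) ^+ 2.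
  by rewrite nrm_sqr; case: (dot x y) => a b /=; ring.
rewrite (_ : _ - _ = nrm y ^+ 2 * ((nrm x * nrm y) ^+ 2 - nrm (dot x y) ^+ 2)).
  by rewrite pmulr_rge0 ?exprn_gt0// subr_ge0.
by ring.
Qed.

Lemma Re_dot_le x y : `|complex.Re (dot x y)| <= nrm x * nrm y.
Proof. exact: le_trans (nrm_Re _) (cauchy_schwarz _ _). Qed.

(** * Limits in a Hilbert space *)

(** Completeness for sequences with an explicit modulus, which also bounds the
    distance to the limit. *)
Lemma complete_bound (x : nat -> H) (e : nat -> R) : e @ \oo --> (0 : R) ->
  (forall m n, (m <= n)%N -> nrm (x n - x m) <= e m) ->
  exists l, forall m, nrm (l - x m) <= e m.
Proof.
move=> e0 xe.
have : cauchy (x @ \oo).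
  apply/cauchy_exP => eps eps0.
  have epsR : eps = (complex.Re eps)%:C by rewrite RRe_real ?gtr0_real.
  have r0 : 0 < complex.Re eps by rewrite -ltcR -epsR.
  have /cvgrPdist_lt /(_ _ r0) [N _ eN] := e0.
  exists (x N); exists N => // n /= Nn.
  rewrite -ball_normE /= nrmE epsR ltcR nrmB.
  apply: le_lt_trans (xe _ _ Nn) _.
  by have := eN N (leqnn N); rewrite sub0r normrN; apply: le_lt_trans; exact: ler_norm.
move=> /cauchy_cvgP xl; exists (lim (x @ \oo)) => m.
apply/ler_addgt0Pr => eps eps0.
have /cvgrPdist_lt /(_ eps%:C) [|N _ lN] := xl; first by rewrite ltcR.
have := lN (maxn N m) (leq_maxl _ _); rewrite nrmE ltcR => /ltW le1.
apply: le_trans (nrmBD (x (maxn N m)) _ _) _.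
by rewrite addrC lerD// xe// leq_maxr.
Qed.

Lemma complete_rate (x : nat -> H) (y : nat -> R) (Y : R) : y @ \oo --> Y ->
  (forall n, nrm (x n.+1 - x n) <= y n.+1 - y n) ->
  exists l, forall n, nrm (l - x n) <= Y - y n.
Proof.
move=> yY xy.
have homo m n : (m <= n)%N -> nrm (x n - x m) <= y n - y m.
  move=> /subnK <-; elim: (n - m)%N => [|k IH]; first by rewrite !subrr nrm0.
  apply: le_trans (nrmBD (x (k + m)%N) _ _) _.
  by rewrite addSn -[leRHS](subrKA (y (k + m)%N)) lerD// xy.
have yle n : y n <= Y.
  rewrite -(cvg_lim _ yY)//; apply: nondecreasing_cvgn_le; last exact: cvgP yY.
  apply/nondecreasing_seqP => k; rewrite -subr_ge0.
  exact: le_trans (nrm_ge0 _) (xy k).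
apply: complete_bound => [|m n mn].
  by rewrite -(subrr Y); apply: cvgB yY; exact: cvg_cst.
by apply: le_trans (homo _ _ mn) _; rewrite lerD2r.
Qed.

Lemma closure_nrmP V x :
  closure V x <-> forall e : R, 0 < e -> exists2 y, V y & nrm (x - y) < e.
Proof.
split=> [Vx e e0|Ve B /nbhs_ballP[eps /= eps0 eB]].
  have [|y [Vy]] := Vx (ball x e%:C); first by apply: nbhsx_ballx; rewrite ltcR.
  by rewrite -ball_normE /= nrmE ltcR; exists y.
have epsR : eps = (complex.Re eps)%:C by rewrite RRe_real ?gtr0_real.
have [|y Vy xy] := Ve (complex.Re eps); first by rewrite -ltcR -epsR.
by exists y; split=> //; apply: eB; rewrite -ball_normE /= nrmE epsR ltcR.
Qed.

Lemma closed_nrm V x : closed V ->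
  (forall e : R, 0 < e -> exists2 y, V y & nrm (x - y) < e) -> V x.
Proof. by move=> clV Ve; apply: clV; apply/closure_nrmP. Qed.

Lemma closed_limit V (x : nat -> H) (e : nat -> R) l :
  closed V -> e @ \oo --> (0 : R) -> (forall n, V (x n)) ->
  (forall n, nrm (l - x n) <= e n) -> V l.
Proof.
move=> clV e0 Vx xe; apply: (closed_nrm clV) => eps eps0.
have /cvgrPdist_lt /(_ _ eps0) [N _ eN] := e0.
exists (x N) => //; apply: le_lt_trans (xe N) _.
by have := eN N (leqnn N); rewrite sub0r normrN; apply: le_lt_trans; exact: ler_norm.
Qed.

(** * Subspaces and orthogonal projections *)

Definition linear_subspace V := V 0 /\ forall a x y, V x -> V y -> V (a *: x + y).

Lemma submod_subspace V : submod_closed [in V] -> linear_subspace V.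
Proof.
case=> V0 VD; split; first by move: V0; rewrite inE.
move=> a x y Vx Vy; have := VD a x y; rewrite !inE; exact.
Qed.

Lemma subspace_submod V : linear_subspace V -> submod_closed [in V].
Proof.
case=> V0 VD; split; first by rewrite inE.
by move=> a x y; rewrite !inE; exact: VD.
Qed.

Section Subspace.
Variable V : set H.
Hypothesis subV : linear_subspace V.

Lemma subspace0 : V 0. Proof. by case: subV. Qed.
Lemma subspaceD x y : V x -> V y -> V (x + y).
Proof. by move=> Vx Vy; rewrite -[x]scale1r; apply: subV.2. Qed.
Lemma subspaceZ a x : V x -> V (a *: x).
Proof. by move=> Vx; rewrite -[_ *: _]addr0; apply: subV.2 => //; exact: subspace0. Qed.
Lemma subspaceN x : V x -> V (- x).
Proof. by rewrite -scaleN1r; exact: subspaceZ. Qed.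
Lemma subspaceB x y : V x -> V y -> V (x - y).
Proof. by move=> Vx Vy; apply: subspaceD => //; exact: subspaceN. Qed.

Lemma dot_ext_in x y : V x -> V y -> (forall z, V z -> dot z x = dot z y) -> x = y.
Proof.
move=> Vx Vy xy; apply/eqP; rewrite -subr_eq0; apply/eqP/dot_eq0.
by rewrite dotBr xy ?subrr//; exact: subspaceB.
Qed.

End Subspace.

Lemma cvg_harm2 : (fun n => n.+1%:R^-1 *+ 2) @ \oo --> (0 : R).
Proof.
rewrite -[X in _ --> X](mul0rn _ 2); apply: cvgMn; exact: cvg_harmonic.
Qed.

(** A minimizing sequence for the distance to [V] is Cauchy by the parallelogram
    law, applied to two members whose midpoint is again in [V]. *)
Lemma orthogonal_projection V x : closed V -> linear_subspace V ->
  exists2 k, V k & forall y, V y -> dot y (x - k) = 0.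
Proof.
move=> clV subV.
pose D := [set nrm (x - y) | y in V].
have D0 : D !=set0 by exists (nrm (x - 0)); exists 0 => //; exact: subspace0.
have lbD : lbound D 0 by move=> _ [y _ <-]; exact: nrm_ge0.
have hD : has_inf D by split=> //; exists 0.
pose delta := inf D.
have delta_ge0 : 0 <= delta by exact: lb_le_inf.
have delta_le y : V y -> delta <= nrm (x - y).
  by move=> Vy; apply: ge_inf; [exists 0|exists y].
have minseq n : exists y, V y /\ nrm (x - y) ^+ 2 < delta ^+ 2 + n.+1%:R^-1 ^+ 2.
  pose d' := Num.sqrt (delta ^+ 2 + n.+1%:R^-1 ^+ 2).
  have d'E : d' ^+ 2 = delta ^+ 2 + n.+1%:R^-1 ^+ 2.
    by rewrite sqr_sqrtr// addr_ge0 ?sqr_ge0.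
  have dd' : 0 < d' - delta.
    rewrite subr_gt0 -(@ltr_pXn2r _ 2)// ?nnegrE ?sqrtr_ge0// d'E ltrDl.
    by rewrite exprn_gt0// invr_gt0.
  have [_ [y Vy <-] lty] := inf_adherent dd' hD.
  exists y; split=> //; rewrite -d'E ltr_pXn2r// ?nnegrE ?nrm_ge0 ?sqrtr_ge0//.
  by move: lty; rewrite -/delta [delta + _]addrC subrK.
have [k kP] := choice minseq.
have midpoint y z : V y -> V z ->
    nrm (y - z) ^+ 2 <= (nrm (x - y) ^+ 2 + nrm (x - z) ^+ 2) *+ 2 - (delta *+ 2) ^+ 2.
  move=> Vy Vz; rewrite -parallelogram lerBrDr.
  rewrite (_ : x - y - (x - z) = - (y - z)); last by rewrite !opprB addrC addrA subrK.
  rewrite nrmN addrC lerD2r.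
  have -> : x - y + (x - z) = 2%:R *: (x - 2%:R^-1 *: (y + z)).
    rewrite scalerBr scalerA divff ?pnatr_eq0// scale1r.
    by rewrite scaler_nat mulr2n opprD addrACA.
  rewrite nrmZ -[2%:R]/((2%:R)%:R) -(rmorph_nat (real_complex R)) nrmC.
  rewrite ger0_norm ?ler0n// -(mulr_natl delta) ler_pXn2r// ?nnegrE ?mulr_ge0 ?nrm_ge0//.
  rewrite ler_pM2l ?ltr0n//; apply: delta_le.
  by apply: subspaceZ => //; exact: subspaceD.
have [l lk] : exists l, forall n, nrm (l - k n) <= n.+1%:R^-1 *+ 2.
  apply: complete_bound cvg_harm2 _ => m n mn.
  rewrite -(@ler_pXn2r _ 2)// ?nnegrE ?nrm_ge0 ?mulrn_wge0 ?invr_ge0//.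
  have [Vm km] := kP m; have [Vn kn] := kP n.
  apply: le_trans (midpoint _ _ Vn Vm) _.
  have : n.+1%:R^-1 ^+ 2 <= m.+1%:R^-1 ^+ 2 :> R.
    by rewrite ler_pXn2r ?nnegrE ?invr_ge0// lef_pV2 ?posrE// ler_nat.
  move=> nm; rewrite -(mulr_natr delta) -(mulr_natr m.+1%:R^-1).
  have aux (p q r a b : R) : p < r + a -> q < r + b -> a <= b ->
      (p + q) *+ 2 - r * 2 ^+ 2 <= b * 2 ^+ 2 by lra.
  by rewrite !exprMn; apply: aux kn km nm.
have Vl : V l by apply: closed_limit clV cvg_harm2 _ lk => n; have [] := kP n.
have xl : nrm (x - l) <= delta.
  apply/ler_addgt0Pr => e e0.
  have e2 : 0 < e / 3 by rewrite divr_gt0.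
  have /cvgrPdist_lt /(_ _ e2) [N _ /(_ N (leqnn N))] := @cvg_harmonic R.
  rewrite sub0r normrN /= ger0_norm ?invr_ge0// => Ne.
  apply: le_trans (nrmBD (k N) _ _) _; rewrite (nrmB (k N)).
  have [_ kN] := kP N; have := lk N.
  have N0 : 0 < N.+1%:R^-1 :> R by rewrite invr_gt0.
  have : nrm (x - k N) <= delta + N.+1%:R^-1.
    rewrite -(@ler_pXn2r _ 2)// ?nnegrE ?nrm_ge0 ?addr_ge0 ?invr_ge0//.
    by apply: le_trans (ltW kN) _; rewrite sqrrD lerD2r lerDl mulrn_wge0// mulr_ge0// ltW.
  have aux (a p q r t : R) : a < r / 3 -> p <= t + a -> q <= a *+ 2 -> p + q <= t + r by lra.
  exact: aux.
exists l => // y Vy.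
(* Perturbing the minimizer l by a multiple of y cannot decrease the distance. *)
pose a := dot y (x - l).
suff : nrm a ^+ 2 <= 0.
  by rewrite le_eqVlt ltNge sqr_ge0 orbF sqrf_eq0 => /eqP/nrm_eq0.
pose s := (1 + nrm y ^+ 2)^-1.
have s_gt0 : 0 < s by rewrite invr_gt0 ltr_pwDl// sqr_ge0.
have sy : s * nrm y ^+ 2 <= 1.
  by rewrite mulrC ler_pdivrMr ?mul1r ?lerDr// ltr_pwDl// sqr_ge0.
have : nrm (x - l) ^+ 2 <= nrm (x - l - (s%:C * a^*) *: y) ^+ 2.
  rewrite ler_pXn2r// ?nnegrE ?nrm_ge0//; apply: le_trans xl _.
  rewrite -addrA -opprD; apply: delta_le.
  by apply: subspaceD => //; exact: subspaceZ.
rewrite (nrm_sqrB (x - l)) nrmZ nrmM nrmJ nrmC gtr0_norm// dotZr (dotC (x - l)) -/a.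
have -> : complex.Re ((s%:C * a^*)^* * a^*) = s * nrm a ^+ 2.
  by rewrite nrm_sqr; case: (a) => a1 a2 /=; ring.
have := sqr_ge0 (nrm a); set A := nrm a ^+ 2 => A0.
rewrite !exprMn -/A => h.
have {}h : 0 <= s * (A * (s * nrm y ^+ 2 - 2)) by nra.
rewrite pmulr_rge0// in h.
by nra.
Qed.

End Hilbert.

(** * Linear maps on a subspace and unbounded operators *)

Lemma le_vanishing (R : realType) (C r : R) (e : nat -> R) :
  e @ \oo --> (0 : R) -> (forall n, r <= C * e n) -> r <= 0.
Proof.
move=> e0 rC; have Ce : (fun n => C * e n) @ \oo --> (0 : R).
  by rewrite -[X in _ --> X](mulr0 C); apply: cvgM; [exact: cvg_cst|exact: e0].
rewrite -(cvg_lim _ Ce)//; apply: limr_ge; first exact: cvgP Ce.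
exact: nearW.
Qed.

Section Operators.
Variables (R : realType) (H : completeNormedModType R[i]).
Variable dot : {dot H for Num.conj}.
Hypothesis dotE : hilbert_norm dot.
Implicit Types (x y : H) (V W : set H) (A : operator H) (f : H -> H).

Definition linear_on V f :=
  forall (a : R[i]) x y, V x -> V y -> f (a *: x + y) = a *: f x + f y.

Section LinearOn.
Variables (V : set H) (f : H -> H).
Hypotheses (subV : linear_subspace V) (linf : linear_on V f).

Lemma linear_onD x y : V x -> V y -> f (x + y) = f x + f y.
Proof. by move=> Vx Vy; rewrite -[x]scale1r linf// !scale1r. Qed.
Lemma linear_onB x y : V x -> V y -> f (x - y) = f x - f y.
Proof.
by move=> Vx Vy; rewrite addrC -scaleN1r linf// scaleN1r addrC.
Qed.
Lemma linear_on0 : f 0 = 0.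
Proof.
by rewrite -[X in f X](subrr 0) linear_onB ?subrr//; exact: subspace0.
Qed.
Lemma linear_onZ a x : V x -> f (a *: x) = a *: f x.
Proof.
by move=> Vx; rewrite -[_ *: x]addr0 linf ?linear_on0 ?addr0//; exact: subspace0.
Qed.

End LinearOn.

(** Maps are total functions on [H]; only their values on [V] matter. *)
Definition bounded_map V W f (K : R) : Prop :=
  [/\ forall x, V x -> W (f x), linear_on V f &
      forall x, V x -> nrm (f x) <= K * nrm x].

Lemma opnorm_bound A K : (forall x, opdom A x -> nrm (A x) <= K * nrm x) ->
  0 <= K -> (opnorm A <= K%:E)%E.
Proof.
move=> AK K0; apply: ge_ereal_sup => _ [x [Ax x1] <-].
rewrite lee_fin; apply: le_trans (AK x Ax) _.
by rewrite ler_piMr// -lecR -nrmE.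
Qed.

Lemma opnorm_ge0 A : linear_operator A -> (0 <= opnorm A)%E.
Proof.
move=> [subA linA]; apply: ereal_sup_ubound; exists 0.
  split; last by rewrite normr0 ler01.
  exact: (subspace0 (submod_subspace subA)).
by rewrite (linear_on0 (submod_subspace subA) linA) normr0.
Qed.

Lemma opnorm_le A (K : R) : linear_operator A -> (opnorm A <= K%:E)%E ->
  forall x, opdom A x -> nrm (A x) <= K * nrm x.
Proof.
move=> [/submod_subspace subA linA] AK x Ax.
have [->|/eqP x0] := eqVneq x 0.
  by rewrite (linear_on0 subA linA) !nrm0 mulr0.
have x_gt0 : 0 < nrm x.
  by rewrite lt_neqAle nrm_ge0 andbT eq_sym; apply/eqP => /nrm_eq0.
rewrite -ler_pdivrMr// -lee_fin; apply: le_trans AK.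
apply: ereal_sup_ubound; exists ((nrm x)^-1%:C *: x).
  split; first exact: subspaceZ.
  rewrite nrmE nrmZ nrmC ger0_norm ?invr_ge0 ?nrm_ge0// mulVf ?lexx//.
  exact: lt0r_neq0.
congr EFin; rewrite (linear_onZ subA linA)// -/(nrm _) nrmZ nrmC.
by rewrite ger0_norm ?invr_ge0 ?nrm_ge0// mulrC.
Qed.

Lemma opinvP A y : opdom (opinv A) y ->
  opdom A (opinv A y) /\ A (opinv A y) = y.
Proof.
case=> x Ax Axy; rewrite /opinv /=.
by have := @xgetPex _ 0 [set x | opdom A x /\ A x = y] (ex_intro _ x (conj Ax Axy)).
Qed.

Lemma opinvK A x : (forall x y, opdom A x -> opdom A y -> A x = A y -> x = y) ->
  opdom A x -> opinv A (A x) = x.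
Proof.
move=> injA Ax; have [|dA AE] := @opinvP A (A x); first by exists x.
exact: injA.
Qed.

(** * Selfadjoint operators *)

Lemma dense_orthogonal (D : set H) x :
  closure D x -> (forall y, D y -> dot y x = 0) -> x = 0.
Proof.
move=> Dx xD; apply: nrm_eq0; apply/eqP; rewrite eq_le nrm_ge0 andbT leNgt.
apply/negP => x0.
have /closure_nrmP /(_ _ x0) [y Dy xy] := Dx.
have : nrm x ^+ 2 <= nrm (x - y) * nrm x.
  apply: le_trans (cauchy_schwarz dotE _ _).
  by rewrite dotBl (xD y)// subr0 dot_nrm// nrmC ger0_norm ?sqr_ge0.
by rewrite expr2 ler_pM2r// leNgt xy.
Qed.

Section Selfadjoint.
Variables (V : set H) (A : operator H).
Hypotheses (clV : closed_subspace V) (saA : selfadjoint dot V A).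

Let subV : linear_subspace V. Proof. by case: clV => _ /submod_subspace. Qed.

Lemma sa_subspace : linear_subspace (opdom A).
Proof. by case: saA => [[/submod_subspace]]. Qed.

Lemma sa_linear : linear_on (opdom A) A.
Proof. by case: saA => [[]]. Qed.

Lemma sa_dom_sub x : opdom A x -> V x.
Proof. by case: saA => _ <- _ _; exact: subset_closure. Qed.

Lemma sa_range x : opdom A x -> V (A x).
Proof. by case: saA => _ _ + _; apply. Qed.

Lemma sa_sym x y : opdom A x -> opdom A y -> dot (A x) y = dot x (A y).
Proof.
case: saA => _ _ _ [domE AE] Ax Ay.
have := Ay; rewrite domE => -[_ exz].
rewrite (AE y Ay) /=.
by have [_] := xgetPex 0 exz; apply.
Qed.

Lemma sa_dense x : V x -> (forall y, opdom A y -> dot y x = 0) -> x = 0.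
Proof. by move=> Vx; apply: (@dense_orthogonal (opdom A)); case: saA => _ ->. Qed.

Lemma sa_dom y z : V y -> V z ->
  (forall x, opdom A x -> dot (A x) y = dot x z) -> opdom A y /\ A y = z.
Proof.
move=> Vy Vz yz.
have Ay : opdom A y.
  by case: saA => _ _ _ [-> _]; split=> //; exists z.
split=> //; apply/eqP; rewrite -subr_eq0; apply/eqP; apply: sa_dense.
  by apply: (subspaceB subV) => //; exact: sa_range.
by move=> x Ax; rewrite dotBr -yz// -sa_sym// subrr.
Qed.

Lemma sa_real x : opdom A x -> dot (A x) x = (complex.Re (dot (A x) x))%:C.
Proof.
move=> Ax; apply/esym/RRe_real/complex_realP.
have := dotC dot (A x) x; rewrite -sa_sym//.
case: (dot (A x) x) => a b [/eqP]; rewrite -subr_eq0 opprK -mulr2n.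
by rewrite mulrn_eq0 => /eqP ->; exists a.
Qed.

(** The range of A - z is closed by the lower bound, and its orthogonal
    complement is the kernel of A - z^*, which the second lower bound kills. *)
Lemma sa_surjective (z : R[i]) (c : R) : 0 < c ->
  (forall x, opdom A x -> c * nrm x <= nrm (A x - z *: x)) ->
  (forall x, opdom A x -> c * nrm x <= nrm (A x - z^* *: x)) ->
  forall y, V y -> exists2 x, opdom A x & A x - z *: x = y.
Proof.
move=> c0 cz czJ.
pose K := [set A x - z *: x | x in opdom A].
have linK a x1 x2 : opdom A x1 -> opdom A x2 ->
    A (a *: x1 + x2) - z *: (a *: x1 + x2) = a *: (A x1 - z *: x1) + (A x2 - z *: x2).
  move=> Ax1 Ax2; rewrite sa_linear// scalerDr scalerBr !scalerA (mulrC z a).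
  by rewrite opprD addrACA.
have sA := sa_subspace.
have gB x1 x2 : opdom A x1 -> opdom A x2 ->
    A (x1 - x2) - z *: (x1 - x2) = (A x1 - z *: x1) - (A x2 - z *: x2).
  move=> Ax1 Ax2; have -> : x1 - x2 = -1 *: x2 + x1 by rewrite scaleN1r addrC.
  by rewrite linK// scaleN1r addrC.
have subK : linear_subspace K.
  split.
    exists 0; first exact: subspace0.
    by rewrite (linear_on0 sA sa_linear) scaler0 subr0.
  move=> a _ _ [x1 Ax1 <-] [x2 Ax2 <-]; exists (a *: x1 + x2); last exact: linK.
  exact: sA.2.
have KV y : K y -> V y.
  move=> [x Ax <-]; apply: (subspaceB subV); first exact: sa_range.
  by apply: (subspaceZ subV); exact: sa_dom_sub.
have clK : closed K.
  move=> y /closure_nrmP Ky.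
  have Vy : V y.
    apply: (closed_nrm clV.1) => e e0.
    by have [y' /KV Vy' yy'] := Ky _ e0; exists y'.
  have /choice [x xP] : forall n, exists x, opdom A x /\
      nrm (y - (A x - z *: x)) <= n.+1%:R^-1.
    move=> n; have [|_ [x Ax <-] /ltW yx] := Ky n.+1%:R^-1; first by rewrite invr_gt0.
    by exists x.
  have xAD m n : opdom A (x n - x m).
    by apply: (subspaceB sA); [have [] := xP n|have [] := xP m].
  have lim0 : (fun n => c^-1 * (n.+1%:R^-1 *+ 2)) @ \oo --> (0 : R).
    by rewrite -[X in _ --> X](mulr0 c^-1); apply: cvgM; [exact: cvg_cst|exact: cvg_harm2].
  have [l lx] : exists l, forall n, nrm (l - x n) <= c^-1 * (n.+1%:R^-1 *+ 2).
    apply: complete_bound => // m n mn.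
    rewrite ler_pdivlMl//; apply: le_trans (cz _ (xAD m n)) _.
    have [Am ym] := xP m; have [An yn] := xP n.
    rewrite gB//; apply: le_trans (nrmBD y _ _) _.
    rewrite (nrmB _ y) mulr2n lerD//; apply: le_trans yn _.
    by rewrite lef_pV2 ?posrE// ler_nat.
  have Vl : V l.
    by apply: closed_limit clV.1 lim0 _ lx => n; apply: sa_dom_sub; have [] := xP n.
  have [||Al AlE] := @sa_dom l (y + z *: l) Vl.
  - by apply: (subspaceD subV) => //; exact: subspaceZ.
  - move=> u Au; apply/eqP; rewrite -subr_eq0; apply/eqP/nrm_eq0/eqP.
    rewrite eq_le nrm_ge0 andbT.
    apply: (le_vanishing (C := (nrm (A u) + nrm z * nrm u) * (c^-1 *+ 2) + nrm u)
      (@cvg_harmonic R)) => n; rewrite /harmonic /=.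
    have [An yn] := xP n.
    have -> : dot (A u) l - dot u (y + z *: l) =
        dot (A u) (l - x n) - dot u (y - (A (x n) - z *: x n)) - dot u (z *: (l - x n)).
      rewrite !dotBr !dotDr scalerBr dotBr (sa_sym Au An); ring.
    apply: le_trans (nrmD _ _) _; rewrite nrmN.
    apply: le_trans (lerD (nrmD _ _) (cauchy_schwarz dotE _ _)) _.
    rewrite nrmN nrmZ.
    apply: le_trans (lerD (lerD (cauchy_schwarz dotE _ _) (cauchy_schwarz dotE _ _)) (lexx _)) _.
    have := lx n; set p := nrm (l - x n); set q := nrm (y - _) in yn *.
    move: p q yn => p q qt pt.
    have h1 : 0 <= (nrm (A u) + nrm z * nrm u) * (c^-1 * (n.+1%:R^-1 *+ 2) - p).
      by rewrite mulr_ge0 ?subr_ge0// addr_ge0 ?mulr_ge0 ?nrm_ge0.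
    have h2 : 0 <= nrm u * (n.+1%:R^-1 - q) by rewrite mulr_ge0 ?subr_ge0 ?nrm_ge0.
    rewrite -subr_ge0; apply: le_trans (addr_ge0 h1 h2) _.
    by rewrite le_eqVlt; apply/orP; left; apply/eqP; ring.
  - by exists l => //; rewrite AlE addrK.
move=> y Vy; have [k [x Ax kE] yk] := orthogonal_projection dotE y clK subK.
have Vw : V (y - k) by apply: (subspaceB subV) => //; apply: KV; exists x.
have [||Aw AwE] := @sa_dom (y - k) (z^* *: (y - k)) Vw.
- exact: subspaceZ.
- move=> u Au; apply/eqP; rewrite -subr_eq0 dotZrJ -dotZl -dotBl.
  by rewrite yk//; exists u.
exists x => //; rewrite kE; apply/esym/eqP; rewrite -subr_eq0; apply/eqP/nrm_eq0.
have := czJ _ Aw; rewrite AwE subrr nrm0 pmulr_rle0// => h.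
by apply/eqP; rewrite eq_le h nrm_ge0.
Qed.

End Selfadjoint.
End Operators.

(** * Resolvents of selfadjoint operators *)

Section Resolvent.
Variables (R : realType) (H : completeNormedModType R[i]).
Variable dot : {dot H for Num.conj}.
Hypothesis dotE : hilbert_norm dot.
Variables (V : set H) (A : operator H).
Hypotheses (clV : closed_subspace V) (saA : selfadjoint dot V A).

Let subV : linear_subspace V. Proof. by case: clV => _ /submod_subspace. Qed.

(** The numerical range of A stays at distance at least delta from d. *)
Definition numerical_gap (d delta : R) := forall x, opdom A x ->
  delta * nrm x ^+ 2 <= `|complex.Re (dot (A x) x) - d * nrm x ^+ 2|.

Lemma le_cancel_nrm (a b : R) (x : H) :
  0 <= b -> a * nrm x ^+ 2 <= b * nrm x -> a * nrm x <= b.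
Proof.
move=> b0; have := nrm_ge0 x; rewrite le_eqVlt => /orP[/eqP <-|x0].
  by rewrite !mulr0.
by rewrite expr2 mulrA ler_pM2r.
Qed.

Lemma dot_resolvent d zeta x : opdom A x ->
  dot (A x - (d +i* zeta) *: x) x =
  (complex.Re (dot (A x) x) - d * nrm x ^+ 2) +i* (- (zeta * nrm x ^+ 2)).
Proof.
move=> Ax; rewrite dotBl dotZl (sa_real saA Ax) (dot_nrm dotE).
by apply/eqP; rewrite eq_complex /=; apply/andP; split; apply/eqP; ring.
Qed.

Section Gap.
Variables (d delta : R).
Hypotheses (delta0 : 0 < delta) (gap : numerical_gap d delta).

Lemma gap_lower zeta x : opdom A x ->
  delta * nrm x <= nrm (A x - (d +i* zeta) *: x).
Proof.
move=> Ax; apply: (@le_cancel_nrm _ _ x); first exact: nrm_ge0.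
apply: le_trans (gap Ax) _; apply: le_trans (cauchy_schwarz dotE _ _).
by rewrite dot_resolvent//; apply: le_trans (nrm_Re _).
Qed.

Lemma imag_lower zeta x : opdom A x ->
  `|zeta| * nrm x <= nrm (A x - (d +i* zeta) *: x).
Proof.
move=> Ax; apply: (@le_cancel_nrm _ _ x); first exact: nrm_ge0.
apply: le_trans (cauchy_schwarz dotE _ _).
rewrite dot_resolvent//; apply: le_trans (nrm_Im _).
by rewrite /= normrN normrM (ger0_norm (sqr_ge0 _)).
Qed.

Lemma gap_injective zeta x y : opdom A x -> opdom A y ->
  A x - (d +i* zeta) *: x = A y - (d +i* zeta) *: y -> x = y.
Proof.
move=> Ax Ay xy; apply/eqP; rewrite -subr_eq0; apply/eqP/nrm_eq0.
have Axy : opdom A (x - y) by apply: (subspaceB (sa_subspace saA)).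
have := gap_lower zeta Axy.
rewrite (linear_onB (sa_linear saA))// scalerBr opprD addrACA -opprD xy subrr nrm0.
by rewrite pmulr_rle0// => h; apply/eqP; rewrite eq_le h nrm_ge0.
Qed.

Lemma resolventP zeta y : V y ->
  opdom A (resolvent A (d +i* zeta) y) /\
  A (resolvent A (d +i* zeta) y) - (d +i* zeta) *: resolvent A (d +i* zeta) y = y.
Proof.
move=> Vy; pose Az := Operator (opdom A) (fun x => A x - (d +i* zeta) *: x).
suff /opinvP : opdom (opinv Az) y by [].
have [x Ax xy] := @sa_surjective _ _ _ dotE _ _ clV saA (d +i* zeta) delta
  delta0 (@gap_lower zeta) (@gap_lower (- zeta)) y Vy.
by exists x.
Qed.

Lemma resolvent_bound zeta y : V y ->
  delta * nrm (resolvent A (d +i* zeta) y) <= nrm y.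
Proof.
by move=> /(resolventP zeta) [Ar rE]; have := gap_lower zeta Ar; rewrite rE.
Qed.

(** Adding the bounds by the real and by the imaginary distance. *)
Lemma resolvent_decay zeta y : V y ->
  nrm (d +i* zeta) * nrm (resolvent A (d +i* zeta) y) <= (`|d| / delta + 1) * nrm y.
Proof.
move=> Vy; have [Ar rE] := resolventP zeta Vy.
have h1 := resolvent_bound zeta Vy.
have h2 := imag_lower zeta Ar; rewrite rE in h2.
apply: le_trans (ler_wpM2r (nrm_ge0 _) (nrm_le_ReIm _)) _ => /=.
rewrite mulrDl [leRHS]mulrDl mul1r lerD// -mulrA ler_wpM2l//.
by rewrite mulrC ler_pdivlMr// mulrC.
Qed.

End Gap.

Lemma gap_surjective delta : 0 < delta -> numerical_gap 0 delta ->
  forall y, V y -> opdom A (opinv A y) /\ A (opinv A y) = y.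
Proof.
move=> delta0 gap y Vy; apply: opinvP.
have [x Ax xy] := @sa_surjective _ _ _ dotE _ _ clV saA 0 delta
  delta0 (gap_lower gap 0) (gap_lower gap (- 0)) y Vy.
by exists x => //; rewrite -xy scale0r subr0.
Qed.

End Resolvent.

(** * Square roots *)

Section OperatorLimit.
Variables (R : realType) (H : completeNormedModType R[i]).
Implicit Types (V W : set H) (f : H -> H).

(** A scalar sequence majorizing the increments gives a limit operator together
    with a rate, from which identities pass to the limit. *)
Lemma operator_limit V W (f : nat -> H -> H) (y : nat -> R) (Y : R) :
  linear_subspace V -> closed W -> y @ \oo --> Y ->
  (forall n x, V x -> W (f n x)) -> (forall n, linear_on V (f n)) ->
  (forall n x, V x -> nrm (f n.+1 x - f n x) <= (y n.+1 - y n) * nrm x) ->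
  exists g, [/\ forall x, V x -> W (g x), linear_on V g &
    forall n x, V x -> nrm (g x - f n x) <= (Y - y n) * nrm x].
Proof.
move=> subV clW yY fW flin frate.
have /choice [g gP] : forall x, exists l, V x ->
    forall n, nrm (l - f n x) <= (Y - y n) * nrm x.
  move=> x; have [Vx|nVx] := pselect (V x); last by exists 0.
  have [||l lP] := @complete_rate _ _ (f^~ x) (fun n => y n * nrm x) (Y * nrm x).
  - by apply: cvgM => //; exact: cvg_cst.
  - by move=> n; rewrite -mulrBl; exact: frate.
  by exists l => _ n; rewrite mulrBl.
have e0 : (fun n => Y - y n) @ \oo --> (0 : R).
  by rewrite -(subrr Y); apply: cvgB => //; exact: cvg_cst.
exists g; split; last by move=> n x Vx; exact: gP.
  move=> x Vx; apply: (@closed_limit _ _ W (f^~ x) (fun n => (Y - y n) * nrm x)) => //.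
  - by rewrite -(mul0r (nrm x)); apply: cvgM => //; exact: cvg_cst.
  - by move=> n; exact: fW.
  - exact: gP.
move=> a u v Vu Vv.
apply/eqP; rewrite -subr_eq0; apply/eqP/nrm_eq0/eqP; rewrite eq_le nrm_ge0 andbT.
apply: (le_vanishing (C := nrm (a *: u + v) + (nrm a * nrm u + nrm v)) e0) => n.
have Vauv : V (a *: u + v) by exact: subV.2.
apply: le_trans (nrmBD (f n (a *: u + v)) _ _) _.
rewrite [leRHS]mulrC mulrDr lerD ?gP// flin// opprD addrACA -scalerBr.
apply: le_trans (nrmD _ _) _; rewrite mulrDr lerD// ?nrmZ (nrmB (f n _)) ?gP//.
by rewrite mulrCA ler_wpM2l ?nrm_ge0// gP.
Qed.

End OperatorLimit.

Section SquareRoot.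
Variables (R : realType) (H : completeNormedModType R[i]).
Variable dot : {dot H for Num.conj}.
Hypothesis dotE : hilbert_norm dot.
Variable V : set H.
Hypothesis clV : closed_subspace V.
Let subV : linear_subspace V. Proof. by case: clV => _ /submod_subspace. Qed.

(** The scalar iteration dominating the operator iteration below. *)
Fixpoint root_majorant n : R :=
  if n is m.+1 then (1 + root_majorant m ^+ 2) / 2 else 0.

Lemma root_majorant_bounds n :
  [/\ 0 <= root_majorant n, root_majorant n <= 1 & root_majorant n <= root_majorant n.+1].
Proof.
elim: n => [|n [h0 h1 h2]] /=; first by split; lra.
by move: h0 h1 h2 => /=; set r := root_majorant n => h0 h1 h2; split; nra.
Qed.

Lemma root_majorant_cvg : exists2 r : R, r <= 1 & root_majorant @ \oo --> r.
Proof.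
have nd : nondecreasing_seq root_majorant.
  by apply/nondecreasing_seqP => n; have [] := root_majorant_bounds n.
have ub : has_ubound (range root_majorant).
  by exists 1 => _ [n _ <-]; have [] := root_majorant_bounds n.
exists (limn root_majorant); last exact: nondecreasing_is_cvgn.
apply: limr_le; first exact: nondecreasing_is_cvgn.
by apply: nearW => n; have [] := root_majorant_bounds n.
Qed.

Variable C : H -> H.
Hypotheses (CV : forall x, V x -> V (C x)) (Clin : linear_on V C)
  (Csym : forall x y, V x -> V y -> dot (C x) y = dot x (C y))
  (Ccontr : forall x, V x -> nrm (C x) <= nrm x).

Fixpoint root_iter n (x : H) : H :=
  if n is m.+1 then (2^-1 : R)%:C *: (C x + root_iter m (root_iter m x)) else 0.

Lemma root_iterV n x : V x -> V (root_iter n x).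
Proof.
elim: n x => [|n IH] x Vx /=; first exact: subspace0.
by apply: subspaceZ => //; apply: subspaceD => //; [exact: CV|apply/IH/IH].
Qed.

Lemma root_iter_linear n : linear_on V (root_iter n).
Proof.
elim: n => [|n IH] a x y Vx Vy /=; first by rewrite scaler0 addr0.
rewrite Clin// !IH//; try exact: root_iterV.
by rewrite !scalerDr !scalerA (mulrC a) addrACA.
Qed.

Lemma root_iter_sym n x y : V x -> V y ->
  dot (root_iter n x) y = dot x (root_iter n y).
Proof.
elim: n x y => [|n IH] x y Vx Vy /=; first by rewrite dot0l dot0r.
rewrite dotZl dotZr_real dotDl dotDr Csym// !IH//; exact: root_iterV.
Qed.

Lemma root_iter_bound n x : V x -> nrm (root_iter n x) <= root_majorant n * nrm x.
Proof.
elim: n x => [|n IH] x Vx /=; first by rewrite nrm0 mul0r.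
have [r0 r1 _] := root_majorant_bounds n.
have := Ccontr Vx; have := IH _ Vx; have := IH _ (root_iterV n Vx).
rewrite nrmZ_ge0 ?invr_ge0//.
have := nrmD (C x) (root_iter n (root_iter n x)); have := nrm_ge0 x.
move: (nrm (_ + _)) (nrm (root_iter n (root_iter n x))) (nrm (C x)).
move: (nrm (root_iter n x)) (nrm x).
move: (root_majorant n) r0 r1 => r r0 r1 u v p q t v0 ptq qr uv tv.
have : q <= r * (r * v) by apply: le_trans qr _; rewrite ler_wpM2l.
by nra.
Qed.

Lemma root_iter_rate n x : V x -> nrm (root_iter n.+1 x - root_iter n x) <=
  (root_majorant n.+1 - root_majorant n) * nrm x.
Proof.
elim: n x => [|n IH] x Vx.
  rewrite /= !subr0 addr0 expr0n/= addr0 nrmZ_ge0 ?invr_ge0// mul1r.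
  by rewrite ler_wpM2l ?invr_ge0//; exact: Ccontr.
(* Y^2 - Z^2 = Y (Y - Z) + (Y - Z) Z *)
have -> : root_iter n.+2 x - root_iter n.+1 x = (2^-1 : R)%:C *:
   (root_iter n.+1 (root_iter n.+1 x - root_iter n x) +
    (root_iter n.+1 (root_iter n x) - root_iter n (root_iter n x))).
  rewrite [LHS]/= -/(root_iter n.+1 _) -scalerBr; congr (_ *: _).
  rewrite (linear_onB (root_iter_linear n.+1)); try exact: root_iterV.
  by rewrite addrA subrK opprD addrACA subrr add0r.
rewrite nrmZ_ge0 ?invr_ge0//.
have Vn := root_iterV n Vx; have Vn1 := root_iterV n.+1 Vx.
have h1 := root_iter_bound n.+1 (subspaceB subV Vn1 Vn).
have h2 := IH _ Vx; have h3 := IH _ Vn; have h4 := root_iter_bound n Vx.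
have [r0 r1 rr] := root_majorant_bounds n; have [s0 s1 _] := root_majorant_bounds n.+1.
have -> : root_majorant n.+2 = (1 + root_majorant n.+1 ^+ 2) / 2 by [].
have sE : root_majorant n.+1 = (1 + root_majorant n ^+ 2) / 2 by [].
apply: le_trans (ler_wpM2l _ (nrmD _ _)) _; first by rewrite invr_ge0.
apply: le_trans (ler_wpM2l _ (lerD h1 h3)) _; first by rewrite invr_ge0.
apply: le_trans (ler_wpM2l _ (lerD (ler_wpM2l s0 h2) (ler_wpM2l _ h4))) _.
- by rewrite invr_ge0.
- by rewrite subr_ge0.
move: (root_majorant n) (root_majorant n.+1) sE => r s sE.
have r2E : r ^+ 2 = 2 * s - 1 by rewrite sE; field.
rewrite le_eqVlt; apply/orP; left; apply/eqP.
transitivity (2^-1 * (s ^+ 2 - r ^+ 2) * nrm x); first by ring.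
by rewrite r2E; field.
Qed.

(** Solving 2 Y = C + Y^2 by iteration; S = 1 - Y is then a root of 1 - C. *)
Lemma contraction_sqrt : exists S : H -> H,
  [/\ forall x, V x -> V (S x), linear_on V S,
      forall x y, V x -> V y -> dot (S x) y = dot x (S y),
      forall x, V x -> 0 <= complex.Re (dot (S x) x) &
      forall x, V x -> S (S x) = x - C x].
Proof.
have [r r1 rcvg] := root_majorant_cvg.
have e0 : (fun n => r - root_majorant n) @ \oo --> (0 : R).
  by rewrite -(subrr r); apply: cvgB => //; exact: cvg_cst.
have [Y [YV Ylin Yrate]] := operator_limit subV clV.1 rcvg root_iterV
  root_iter_linear root_iter_rate.
have Ybound x : V x -> nrm (Y x) <= nrm x.
  move=> Vx; have := Yrate 0%N x Vx; rewrite /= !subr0 => /le_trans; apply.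
  by rewrite ler_piMl ?nrm_ge0.
have Ysym x y : V x -> V y -> dot (Y x) y = dot x (Y y).
  move=> Vx Vy; apply/eqP; rewrite -subr_eq0; apply/eqP/nrm_eq0/eqP.
  rewrite eq_le nrm_ge0 andbT.
  apply: (le_vanishing (C := nrm x * nrm y *+ 2) e0) => n.
  have -> : dot (Y x) y - dot x (Y y) =
      dot (Y x - root_iter n x) y - dot x (Y y - root_iter n y).
    by rewrite dotBl dotBr root_iter_sym// opprB addrA subrK.
  apply: le_trans (nrmD _ _) _; rewrite nrmN mulr2n mulrDl.
  rewrite lerD//; apply: le_trans (cauchy_schwarz dotE _ _) _.
    by rewrite [leRHS]mulrC mulrA ler_wpM2r ?nrm_ge0// Yrate.
  by rewrite -mulrA ler_wpM2l ?nrm_ge0// mulrC Yrate.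
have YE x : V x -> Y x + Y x = C x + Y (Y x).
  move=> Vx; apply/eqP; rewrite -subr_eq0; apply/eqP/nrm_eq0/eqP.
  rewrite eq_le nrm_ge0 andbT.
  have e1 : (fun n => (r - root_majorant n.+1) *+ 2 + (r - root_majorant n) *+ 2) @ \oo --> (0 : R).
    rewrite -[X in _ --> X](addr0 0) -{1}(mul0rn R 2) -{2}(mul0rn R 2).
    apply: cvgD; apply: cvgMn => //.
    by move: e0; rewrite -(cvg_shiftS (fun n => r - root_majorant n)).
  apply: (le_vanishing (C := nrm x) e1) => n.
  have Vn := root_iterV n Vx.
  have iterE : root_iter n.+1 x + root_iter n.+1 x = C x + root_iter n (root_iter n x).
    by rewrite /= -mulr2n scalerMnl -rmorphMn /= -mulr_natr mulVf ?pnatr_eq0// scale1r.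
  have split4 (a b c d e : H) : b + b = c + e -> a + a - (c + d) = (a - b) + (a - b) - (d - e).
    by move=> bE; rewrite addrACA -opprD bE opprB -[RHS]addrA !opprD -[X in _ = _ + X]addrA addKr.
  rewrite (split4 _ _ _ _ _ iterE).
  have h1 := Yrate n.+1 _ Vx.
  have h2 := Yrate n _ (YV _ Vx).
  have h3 := root_iter_bound n (subspaceB subV (YV _ Vx) Vn).
  have h4 := Yrate n _ Vx.
  have h5 : nrm (Y (Y x) - root_iter n (root_iter n x)) <=
      (r - root_majorant n) * nrm x *+ 2.
    apply: le_trans (nrmBD (root_iter n (Y x)) _ _) _.
    rewrite mulr2n lerD//.
      apply: le_trans h2 _; rewrite ler_wpM2l ?Ybound// subr_ge0.
      rewrite -(cvg_lim _ rcvg)//; apply: nondecreasing_cvgn_le; last exact: cvgP rcvg.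
      by apply/nondecreasing_seqP => k; have [] := root_majorant_bounds k.
    rewrite -(linear_onB (root_iter_linear n)) //; last exact: YV.
    apply: le_trans h3 _; apply: le_trans _ h4.
    by rewrite ler_piMl ?nrm_ge0//; have [] := root_majorant_bounds n.
  apply: le_trans (nrmD _ _) _; rewrite nrmN mulrDr.
  rewrite lerD//; last by rewrite [leRHS]mulrC mulrnAl.
  apply: le_trans (nrmD _ _) _.
  by rewrite [leRHS]mulrC mulrnAl mulr2n lerD.
exists (fun x => x - Y x); split.
- by move=> x Vx; apply: (subspaceB subV) => //; exact: YV.
- by move=> a x y Vx Vy; rewrite Ylin// scalerBr opprD addrACA.
- by move=> x y Vx Vy; rewrite dotBl dotBr Ysym.
- move=> x Vx; rewrite dotBl raddfB /= subr_ge0 (dot_nrm dotE) /= expr2.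
  apply: le_trans (ler_norm _) _; apply: le_trans (Re_dot_le dotE _ _) _.
  by rewrite ler_wpM2r ?nrm_ge0// Ybound.
move=> x Vx; rewrite (linear_onB Ylin)//; last exact: YV.
by rewrite -addrA -opprD addrA YE// addrK.
Qed.

End SquareRoot.

(** * Positive definite operators and their square roots *)

Section PositiveDefinite.
Variables (R : realType) (H : completeNormedModType R[i]).
Variable dot : {dot H for Num.conj}.
Hypothesis dotE : hilbert_norm dot.
Variables (V : set H) (A : operator H).
Hypothesis clV : closed_subspace V.

Let subV : linear_subspace V. Proof. by case: clV => _ /submod_subspace. Qed.

(** A symmetric operator with dense domain is selfadjoint as soon as its adjoint
    has no larger domain; the values then agree by density. *)
Lemma selfadjoint_intro (Q : operator H) :
  linear_operator Q -> closure (opdom Q) = V ->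
  (forall x, opdom Q x -> V (Q x)) ->
  (forall x y, opdom Q x -> opdom Q y -> dot (Q x) y = dot x (Q y)) ->
  (forall y z, V y -> V z -> (forall x, opdom Q x -> dot (Q x) y = dot x z) ->
     opdom Q y) ->
  selfadjoint dot V Q.
Proof.
move=> linQ clQ QV Qsym Qmax; split=> //.
have dom_sub x : opdom Q x -> V x by rewrite -clQ; exact: subset_closure.
split=> [|y Qy].
  apply/seteqP; split=> [y Qy|y [Vy [z [Vz yz]]]]; last exact: Qmax Vy Vz yz.
  split; first exact: dom_sub.
  by exists (Q y); split; [exact: QV|move=> x Qx; exact: Qsym].
rewrite /adjoint /=.
set P := [set z | _].
have [Vz zP] : P (xget 0 P).
  by apply: (@xgetPex _ 0); exists (Q y); split; [exact: QV|move=> x Qx; exact: Qsym].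
apply/eqP; rewrite -subr_eq0; apply/eqP/(dense_orthogonal dotE (D := opdom Q)).
  by rewrite clQ; apply: (subspaceB subV) => //; exact: QV.
by move=> x Qx; rewrite dotBr -zP// Qsym// subrr.
Qed.

Hypothesis saA : selfadjoint dot V A.

Definition form_lower (c : R) :=
  forall x, opdom A x -> c * nrm x ^+ 2 <= complex.Re (dot (A x) x).

Lemma form_lower_gap c d : form_lower c -> numerical_gap dot A d (c - d).
Proof.
move=> low x Ax; apply: le_trans (ler_norm _).
by rewrite mulrBl lerD2r low.
Qed.

Section Inverse.
Variable c : R.
Hypotheses (c0 : 0 < c) (low : form_lower c).

Let gap0 : numerical_gap dot A 0 c.
Proof. by have := form_lower_gap 0 low; rewrite subr0. Qed.

Lemma pd_invP y : V y -> opdom A (opinv A y) /\ A (opinv A y) = y.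
Proof. exact: gap_surjective dotE _ _ clV saA _ c0 gap0 y. Qed.

Lemma pd_injective x y : opdom A x -> opdom A y -> A x = A y -> x = y.
Proof.
move=> Ax Ay xy; apply: (gap_injective dotE saA c0 gap0 (zeta := 0)) => //.
by rewrite [_ +i* _](_ : _ = 0)// !scale0r !subr0.
Qed.

Lemma pd_invK x : opdom A x -> opinv A (A x) = x.
Proof. by apply: opinvK; exact: pd_injective. Qed.

Lemma pd_invV y : V y -> V (opinv A y).
Proof. by move=> /pd_invP[/(sa_dom_sub saA)]. Qed.

Lemma pd_inv_linear : linear_on V (opinv A).
Proof.
move=> a x y Vx Vy; have [Ax AxE] := pd_invP Vx; have [Ay AyE] := pd_invP Vy.
have [_ linA] := (sa_subspace saA, sa_linear saA).
rewrite -[in LHS]AxE -[in LHS]AyE -linA// pd_invK//.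
exact: (sa_subspace saA).2.
Qed.

Lemma pd_inv_sym x y : V x -> V y -> dot (opinv A x) y = dot x (opinv A y).
Proof.
move=> Vx Vy; have [Ax AxE] := pd_invP Vx; have [Ay AyE] := pd_invP Vy.
by rewrite -[in RHS]AxE (sa_sym saA)// AyE.
Qed.

(** The spectrum of the inverse lies in the interval from 0 to 1 / c, so that of
    [1 - t A^-1] lies between -1 and 1. *)
Lemma pd_contraction t y : 0 <= t -> t <= 2 * c -> V y ->
  nrm (y - t%:C *: opinv A y) <= nrm y.
Proof.
move=> t0 tc Vy; have [Ax AxE] := pd_invP Vy.
rewrite -(@ler_pXn2r _ 2)// ?nnegrE ?nrm_ge0// (nrm_sqrB dotE) nrmZ_ge0//.
rewrite dotZr_real -[X in _ + _ - complex.Re (_ * dot X _) *+ 2]AxE.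
have := low Ax; set B := opinv A y; case: (dot (A B) B) => p q /= lowB.
rewrite mul0r subr0 exprMn -addrA gerDl.
have := sqr_ge0 (nrm B); move: (nrm B ^+ 2) lowB => b lowB b0.
have h1 : 0 <= t * ((2 * c - t) * b) by rewrite !mulr_ge0// subr_ge0.
have h2 : 0 <= t * (p - c * b) by rewrite mulr_ge0// subr_ge0.
by nra.
Qed.

(** A bounded selfadjoint square root of the inverse, obtained from
    c A^-1 = 1 - (1 - c A^-1). *)
Lemma pd_inv_sqrt : exists S : H -> H,
  [/\ forall x, V x -> V (S x), linear_on V S,
      forall x y, V x -> V y -> dot (S x) y = dot x (S y),
      forall x, V x -> 0 <= complex.Re (dot (S x) x) &
      forall x, V x -> S (S x) = opinv A x].
Proof.
have [||||S [SV Slin Ssym Spos SE]] := @contraction_sqrt _ _ _ dotE _ clV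
    (fun y => y - c%:C *: opinv A y).
- by move=> x Vx; apply: (subspaceB subV) => //; apply: (subspaceZ subV); exact: pd_invV.
- move=> a x y Vx Vy; rewrite pd_inv_linear// scalerDr scalerBr !scalerA (mulrC a).
  by rewrite opprD addrACA.
- move=> x y Vx Vy; rewrite dotBl dotBr dotZl dotZr_real pd_inv_sym//.
- by move=> x Vx; apply: pd_contraction => //; [exact: ltW|have := c0; lra].
pose r := (Num.sqrt c)^-1.
exists (fun x => r%:C *: S x); split.
- by move=> x Vx; apply: (subspaceZ subV); exact: SV.
- by move=> a x y Vx Vy; rewrite Slin// scalerDr !scalerA (mulrC a).
- by move=> x y Vx Vy; rewrite dotZl dotZr_real Ssym.
- move=> x Vx; rewrite dotZl; have := Spos x Vx; case: (dot _ _) => p q /= p0.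
  by rewrite mul0r subr0 mulr_ge0// invr_ge0 sqrtr_ge0.
move=> x Vx /=; rewrite (linear_onZ subV Slin); last exact: SV.
rewrite SE// opprB addrC subrK.
rewrite !scalerA -!rmorphM /= (_ : r * r * c = 1) ?scale1r//.
rewrite /r -expr2 exprVn sqr_sqrtr ?ltW// mulVf//; exact: lt0r_neq0.
Qed.

(** The bounded symmetric root [S] of the inverse is everywhere defined on [V], so
    [(S w, y) = (w, z)] for all [w] forces [y = S z]: the adjoint of [S^-1] has no
    larger domain than [S^-1]. *)
Lemma opsqrt_exists : exists Q, is_opsqrt dot V A Q.
Proof.
have [S [SV Slin Ssym Spos SE]] := pd_inv_sqrt.
have Sinj x y : V x -> V y -> S x = S y -> x = y.
  move=> Vx Vy xy; have := congr1 S xy; rewrite !SE// => /(congr1 A).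
  by have [_ ->] := pd_invP Vx; have [_ ->] := pd_invP Vy.
pose Q := opinv (Operator V S).
have QS x : V x -> Q (S x) = x by exact: (@opinvK _ _ (Operator V S)).
have domQ x : opdom Q x -> exists2 w, V w & x = S w by case=> w Vw <-; exists w.
have Qdom w : V w -> opdom Q (S w) by exists w.
have domE x : opdom A x -> exists2 w, V w & x = S (S w).
  move=> Ax; exists (A x); first exact: (sa_range saA).
  by rewrite SE ?pd_invK//; exact: (sa_range saA).
exists Q; split.
- apply: selfadjoint_intro.
  + split.
      apply: subspace_submod; split.
        by rewrite -(linear_on0 subV Slin); exact: Qdom (subspace0 subV).
      move=> a _ _ /domQ[x Vx ->] /domQ[y Vy ->]; rewrite -Slin//.
      exact/Qdom/subV.2.
    move=> a _ _ /domQ[x Vx ->] /domQ[y Vy ->].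
    by rewrite -Slin// !QS//; exact: subV.2.
  + apply/seteqP; split=> x.
      move=> /closure_nrmP Qx; apply: (closed_nrm clV.1) => e /Qx[_ /domQ[y Vy ->] xy].
      by exists (S y) => //; exact: SV.
    case: (saA) => _ <- _ _; apply: closure_subset => y /domE[w Vw ->].
    exact/Qdom/SV.
  + by move=> _ /domQ[x Vx ->]; rewrite QS.
  + by move=> _ _ /domQ[x Vx ->] /domQ[y Vy ->]; rewrite !QS// Ssym.
  + move=> y z Vy Vz yz; suff -> : y = S z by exact: Qdom.
    apply: (dot_ext_in dotE subV) => //; first exact: SV.
    by move=> w Vw; rewrite -Ssym// -yz ?QS//; exact: Qdom.
- move=> _ /domQ[x Vx ->]; rewrite QS//.
  have := dotC dot x (S x); have := Spos x Vx; rewrite Ssym//.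
  case: (dot x (S x)) => p q /= p0 [/eqP]; rewrite -subr_eq0 opprK -mulr2n.
  by rewrite mulrn_eq0 => /eqP ->; rewrite lecE /= eqxx.
have QQ x : opdom Q x /\ opdom Q (Q x) -> exists2 w, V w & x = S (S w).
  by move=> [/domQ[w Vw ->]]; rewrite QS// => /domQ[w' Vw' ->]; exists w'.
have QQA x : opdom A x -> Q (Q x) = A x.
  move=> /domE[w Vw ->]; rewrite !QS ?SE//; last exact: SV.
  by have [_ ->] := pd_invP Vw.
split=> [|x /QQ[w Vw ->]]; last first.
  by apply: QQA; rewrite SE//; have [] := pd_invP Vw.
apply/seteqP; split=> [x /QQ[w Vw ->]|_ /domE[w Vw ->]].
  by rewrite SE//; have [] := pd_invP Vw.
split; first exact/Qdom/SV.
rewrite QS; first exact: Qdom.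
exact: SV.
Qed.

Section Root.

Let Q := opsqrt dot V A.
Let S := opinv Q.

Lemma opsqrtP : is_opsqrt dot V A Q.
Proof. by apply: xgetPex; exact: opsqrt_exists. Qed.

Let saQ : selfadjoint dot V Q. Proof. by case: opsqrtP. Qed.

Lemma opsqrt_square x : opdom A x -> [/\ opdom Q x, opdom Q (Q x) & Q (Q x) = A x].
Proof.
case: opsqrtP => _ _ [domE QE] Ax.
have dQ : opdom (opcomp Q Q) x by rewrite domE.
by case: (dQ) => Qx QQx; split=> //; exact: QE.
Qed.

Lemma opsqrt_injective x y : opdom Q x -> opdom Q y -> Q x = Q y -> x = y.
Proof.
move=> Qx Qy xy; apply/eqP; rewrite -subr_eq0; apply/eqP.
have Qxy : opdom Q (x - y) by apply: (subspaceB (sa_subspace saQ)).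
have Q0 : Q (x - y) = 0 by rewrite (linear_onB (sa_linear saQ))// xy subrr.
have := opsqrtP => -[_ _ [domE QE]].
have dQ : opdom (opcomp Q Q) (x - y).
  by split=> //; rewrite Q0; exact: subspace0 (sa_subspace saQ).
have Axy : opdom A (x - y) by rewrite -domE.
apply: pd_injective => //; first exact: subspace0 (sa_subspace saA).
rewrite -QE//= Q0 (linear_on0 (sa_subspace saQ) (sa_linear saQ)).
by rewrite (linear_on0 (sa_subspace saA) (sa_linear saA)).
Qed.

Lemma invsqrtK v : opdom Q v -> S (Q v) = v.
Proof. by apply: opinvK; exact: opsqrt_injective. Qed.

Lemma invsqrtE w : V w -> S w = Q (opinv A w).
Proof.
move=> Vw; have [dA AE] := pd_invP Vw; have [Q1 Q2 QE] := opsqrt_square dA.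
by rewrite -{1}AE -QE invsqrtK.
Qed.

Lemma invsqrtP w : V w -> opdom Q (S w) /\ Q (S w) = w.
Proof.
move=> Vw; have [dA AE] := pd_invP Vw; have [Q1 Q2 QE] := opsqrt_square dA.
by rewrite invsqrtE// QE.
Qed.

Lemma invsqrt_square w : V w -> S (S w) = opinv A w.
Proof.
move=> Vw; have [dA AE] := pd_invP Vw; have [Q1 Q2 QE] := opsqrt_square dA.
by rewrite (invsqrtE Vw) invsqrtK.
Qed.

Lemma invsqrtV w : V w -> V (S w).
Proof. by move=> /invsqrtP[/(sa_dom_sub saQ)]. Qed.

Lemma opsqrtV v : opdom Q v -> V (Q v).
Proof. exact: (sa_range saQ). Qed.

Lemma invsqrt_linear : linear_on V S.
Proof.
move=> a x y Vx Vy; have [Qx QxE] := invsqrtP Vx; have [Qy QyE] := invsqrtP Vy.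
rewrite -[in LHS]QxE -[in LHS]QyE -(sa_linear saQ)// invsqrtK//.
exact: (sa_subspace saQ).2.
Qed.

Lemma invsqrt_sym x y : V x -> V y -> dot (S x) y = dot x (S y).
Proof.
move=> Vx Vy; have [Qx QxE] := invsqrtP Vx; have [Qy QyE] := invsqrtP Vy.
by rewrite -[in RHS]QxE (sa_sym saQ)// QyE.
Qed.

Lemma invsqrt_nrm2 w : V w -> nrm (S w) ^+ 2 = complex.Re (dot (opinv A w) w).
Proof.
move=> Vw; rewrite -invsqrt_square// invsqrt_sym//; last exact: invsqrtV.
by rewrite (dot_nrm dotE).
Qed.

(** Writing [x = S (S (A x))] with [S] the root of the inverse, the norm of
    [S (A x)] is the square root of the form [(A x, x)]. *)
Lemma form_lower_inv d : 0 < d ->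
  (forall y, V y -> nrm (opinv A y) <= d^-1 * nrm y) -> form_lower d.
Proof.
move=> d0 bound x Ax.
have VA := sa_range saA Ax; have VS := invsqrtV VA.
have h : nrm x ^+ 2 <= d^-1 * nrm (S (A x)) ^+ 2.
  rewrite -[x in leLHS](pd_invK Ax) -invsqrt_square// invsqrt_nrm2//.
  apply: le_trans (ler_norm _) _; apply: le_trans (Re_dot_le dotE _ _) _.
  by rewrite expr2 mulrA ler_wpM2r ?nrm_ge0// bound.
rewrite -ler_pdivlMl//; apply: le_trans h _.
by rewrite invsqrt_nrm2// pd_invK// Re_dotC.
Qed.

End Root.

End Inverse.

End PositiveDefinite.

Lemma positive_definite_lower (R : realType) (H : completeNormedModType R[i])
    (dot : {dot H for Num.conj}) (V : set H) (A : operator H) :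
  positive_definite dot V A -> exists2 c : R, 0 < c & form_lower dot A c.
Proof.
move=> [saA [c c0 cA]].
have cE : c = (complex.Re c)%:C by rewrite RRe_real ?gtr0_real.
exists (complex.Re c) => [|x Ax]; first by rewrite -ltcR -cE.
have := cA x Ax; rewrite (sa_real saA)// cE nrmE -rmorphXn -rmorphM /=.
by rewrite lecR.
Qed.

(** * Integrals over the real line *)

Section RealLine.
Variable R : realType.
Let mu := @lebesgue_measure R.
Implicit Types (f g G : R -> R).

(** Up to a constant, this dominates all integrands below. *)
Definition lorentzian (t : R) : R := (1 + t ^+ 2)^-1.

Lemma lorentzian_gt0 t : 0 < lorentzian t.
Proof. by rewrite invr_gt0 ltr_pwDl// sqr_ge0. Qed.

Lemma measurable_lorentzian : measurable_fun setT lorentzian.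
Proof. by apply: continuous_measurable_fun; exact: continuous_oneDsqrV. Qed.

Lemma integrable_lorentzian : mu.-integrable setT (EFin \o lorentzian).
Proof.
apply/integrableP; split.
  by apply/measurable_EFinP; exact: measurable_lorentzian.
under eq_integral => x _ do rewrite gee0_abs ?lee_fin ?ltW ?lorentzian_gt0//.
rewrite (@ge0_symfun_integralT _ lorentzian).
- rewrite (_ : [set x | _] = `[0, +oo[%classic); last by rewrite set_itvcy.
  by rewrite integral0y_oneDsqr -EFinM ltry.
- by move=> x; exact/ltW/lorentzian_gt0.
- exact: continuous_oneDsqrV.
- by move=> x /=; rewrite /lorentzian sqrrN.
Qed.

(** Integrability of the limit includes its measurability, so the resolvent
    integrands below need no separate argument for it. *)
Lemma dominated_line (f_ : nat -> R -> R) f (K : R) :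
  (forall n, measurable_fun setT (f_ n)) ->
  (forall n t, `|f_ n t| <= K * lorentzian t) ->
  (forall t, f_ ^~ t @ \oo --> f t) ->
  mu.-integrable setT (EFin \o f) /\
  (fun n => Rintegral mu setT (f_ n)) @ \oo --> Rintegral mu setT f.
Proof.
move=> mf fK ff.
have mlim : measurable_fun setT f.
  by apply: (@measurable_fun_cvg _ _ _ _ f_) => // x _; exact: ff.
have iK : mu.-integrable setT (fun t => (K%:E * (lorentzian t)%:E)%E).
  exact: integrableZl integrable_lorentzian.
have [||||||intf _ cvgf] := @dominated_convergence _ _ _ mu setT _
  (fun n => EFin \o f_ n) (EFin \o f) (fun t => (K%:E * (lorentzian t)%:E)%E).
- by [].
- by move=> n; apply/measurable_EFinP; exact: mf.
- by apply/measurable_EFinP; exact: mlim.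
- by apply: aeW => t _; apply: cvg_EFin; [exact: nearW|exact: ff].
- exact: iK.
- by apply: aeW => t n _; rewrite /= lee_fin.
split=> //; rewrite /Rintegral.
apply: fine_cvg; rewrite fineK //.
exact: integrable_fin_num intf.
Qed.

Lemma line_FTC g G (K L : R) : continuous g ->
  (forall t : R, is_derive t 1 G (g t)) ->
  (forall t, `|g t| <= K * lorentzian t) ->
  (fun n => G n.+1%:R - G (- n.+1%:R)) @ \oo --> L ->
  mu.-integrable setT (EFin \o g) /\ Rintegral mu setT g = L.
Proof.
move=> cg dG gK GL.
pose D n : set R := `[(- n.+1%:R), n.+1%:R]%classic.
have mg : measurable_fun setT g by exact: continuous_measurable_fun.
have [|||intg lim] := @dominated_line (fun n => g \_ (D n)) g K.
- move=> n; apply/(measurable_restrictT _ _).1; first exact: measurable_itv.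
  exact: measurable_funTS.
- move=> n t; rewrite patchE; case: ifPn => // _; rewrite normr0.
  exact: le_trans (normr_ge0 _) (gK t).
- move=> t; apply: cvg_near_cst.
  have [N Nt] : exists N : nat, `|t| <= N%:R.
    exists (Num.bound `|t|); apply: ltW; exact: archi_boundP.
  exists N => // n /= Nn; rewrite patchE mem_set// /D/= in_itv/=.
  have : `|t| <= n.+1%:R by apply: le_trans Nt _; rewrite ler_nat; exact: leqW.
  by rewrite ler_norml.
split=> //.
have FTC n : Rintegral mu setT (g \_ (D n)) = G n.+1%:R - G (- n.+1%:R).
  have -> : Rintegral mu setT (g \_ (D n)) = Rintegral mu (D n) g.
    rewrite /Rintegral [in RHS]integral_mkcond; congr fine; apply: eq_integral => t _.
    by rewrite /= !patchE; case: ifP.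
  rewrite /Rintegral (@continuous_FTC2 _ g G).
  - by rewrite -EFinB.
  - by rewrite gtrN.
  - exact: continuous_subspaceT.
  - have cG (t : R) : {for t, continuous G}.
      by apply/differentiable_continuous/derivable1_diffP; apply: ex_derive.
    split=> [x _| |]; first by apply: ex_derive.
      exact/cvg_at_right_filter/cG.
    exact/cvg_at_left_filter/cG.
  - by move=> x _; rewrite derive1E; apply: derive_val.
rewrite -(cvg_lim (@Rhausdorff R) GL); apply/esym/cvg_lim => //.
by under eq_fun do rewrite -FTC.
Qed.

End RealLine.

(** * Complex-valued functions of a real variable *)

Section ComplexIntegral.
Variable R : realType.
Let mu := @lebesgue_measure R.
Implicit Types (f g : R -> R[i]) (t : R).

Definition has_cintegral f (v : R[i]) := cintegrable f /\ cintegral f = v.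

Lemma reD (a b : R[i]) : complex.Re (a + b) = complex.Re a + complex.Re b.
Proof. by case: a b => [? ?] [? ?]. Qed.
Lemma imD (a b : R[i]) : complex.Im (a + b) = complex.Im a + complex.Im b.
Proof. by case: a b => [? ?] [? ?]. Qed.
Lemma reB (a b : R[i]) : complex.Re (a - b) = complex.Re a - complex.Re b.
Proof. by case: a b => [? ?] [? ?]. Qed.
Lemma imB (a b : R[i]) : complex.Im (a - b) = complex.Im a - complex.Im b.
Proof. by case: a b => [? ?] [? ?]. Qed.
Lemma reM (a b : R[i]) : complex.Re (a * b) =
  complex.Re a * complex.Re b - complex.Im a * complex.Im b.
Proof. by case: a b => [? ?] [? ?]. Qed.
Lemma imM (a b : R[i]) : complex.Im (a * b) =
  complex.Re a * complex.Im b + complex.Im a * complex.Re b.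
Proof. by case: a b => [? ?] [? ?]. Qed.

Lemma complex_eta (a : R[i]) : a = complex.Re a +i* complex.Im a.
Proof. by case: a. Qed.

Lemma eq_has_cintegral f g v : f =1 g -> has_cintegral f v -> has_cintegral g v.
Proof. by move=> /funext ->. Qed.

Lemma has_cintegralD f g v w : has_cintegral f v -> has_cintegral g w ->
  has_cintegral (fun t => f t + g t) (v + w).
Proof.
move=> [[rf jf] <-] [[rg jg] <-]; rewrite /has_cintegral /cintegrable /cintegral.
under [X in _.-integrable _ X]funext do rewrite reD EFinD.
under [X in _ /\ _.-integrable _ X]funext do rewrite imD EFinD.
split; first by split; exact: integrableD.
apply/eqP; rewrite eq_complex /=; apply/andP; split; apply/eqP.
  by rewrite -RintegralD//; apply: eq_Rintegral => t _; rewrite reD.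
by rewrite -RintegralD//; apply: eq_Rintegral => t _; rewrite imD.
Qed.

Lemma has_cintegralZ (c : R[i]) f v : has_cintegral f v ->
  has_cintegral (fun t => c * f t) (c * v).
Proof.
move=> [[rf jf] <-]; rewrite /has_cintegral /cintegrable /cintegral.
have int1 (a b : R) : mu.-integrable setT
    (fun t => (a * complex.Re (f t) + b * complex.Im (f t))%:E).
  under [X in _.-integrable _ X]funext do rewrite EFinD !EFinM.
  by apply: integrableD => //; exact: integrableZl.
have val1 (a b : R) : Rintegral mu setT
    (fun t => a * complex.Re (f t) + b * complex.Im (f t)) =
    a * Rintegral mu setT (fun t => complex.Re (f t)) +
    b * Rintegral mu setT (fun t => complex.Im (f t)).
  rewrite RintegralD ?RintegralZl//.
    by under [X in _.-integrable _ X]funext do rewrite /= EFinM; exact: integrableZl.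
  by under [X in _.-integrable _ X]funext do rewrite /= EFinM; exact: integrableZl.
case: c => a b; split.
  split.
    have := int1 a (- b); congr (_.-integrable _ _); apply/funext => t.
    by rewrite reM /= mulNr.
  have := int1 b a; congr (_.-integrable _ _); apply/funext => t.
  by rewrite imM /= addrC.
apply/eqP; rewrite eq_complex /=; apply/andP; split; apply/eqP.
  rewrite -mulNr -val1; apply: eq_Rintegral => t _; by rewrite reM /= mulNr.
by rewrite addrC -val1; apply: eq_Rintegral => t _; rewrite imM /= addrC.
Qed.

Lemma has_cintegralJ f v : has_cintegral f v -> has_cintegral (fun t => (f t)^*) v^*.
Proof.
move=> [[rf jf] <-].
have ReJ (a : R[i]) : complex.Re a^* = complex.Re a by case: a.
have ImJ (a : R[i]) : complex.Im a^* = -1 * complex.Im a.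
  by case: a => p q /=; rewrite mulN1r.
split.
  split; first by under [X in _.-integrable _ X]funext do rewrite ReJ.
  under [X in _.-integrable _ X]funext do rewrite ImJ EFinM.
  exact: integrableZl.
apply/eqP; rewrite eq_complex /=; apply/andP; split; apply/eqP.
  by apply: eq_Rintegral => t _; rewrite ReJ.
rewrite -mulN1r -RintegralZl//; by apply: eq_Rintegral => t _; rewrite ImJ.
Qed.

Lemma has_cintegral_dominated (f_ : nat -> R -> R[i]) f (v : R[i]) (K : R) :
  (forall n, has_cintegral (f_ n) v) ->
  (forall n t, nrm (f_ n t) <= K * lorentzian t) ->
  (forall t, (fun n => nrm (f t - f_ n t)) @ \oo --> (0 : R)) ->
  has_cintegral f v.
Proof.
move=> fv fK ff.
have part (P : R[i] -> R) : (forall a, `|P a| <= nrm a) ->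
    (forall a b, P (a - b) = P a - P b) ->
    (forall n, mu.-integrable setT (fun t => (P (f_ n t))%:E)) ->
    mu.-integrable setT (fun t => (P (f t))%:E) /\
    (fun n => Rintegral mu setT (fun t => P (f_ n t))) @ \oo
      --> Rintegral mu setT (fun t => P (f t)).
  move=> Pn PB Pint; apply: (@dominated_line _ (fun n t => P (f_ n t)) (fun t => P (f t)) K).
  - by move=> n; apply/measurable_EFinP; case/integrableP: (Pint n).
  - by move=> n t; exact: le_trans (Pn _) (fK n t).
  - move=> t; apply/cvgrPdist_lt => e e0.
    have /cvgrPdist_lt /(_ _ e0) := ff t.
    apply: filterS => n; rewrite sub0r normrN => h.
    rewrite -PB; apply: le_lt_trans (Pn _) _; apply: le_lt_trans h; exact: ler_norm.
have [|||ir cr] := part (@complex.Re R).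
- exact: nrm_Re.
- exact: reB.
- by move=> n; case: (fv n) => [[]].
have [|||ij cj] := part (@complex.Im R).
- exact: nrm_Im.
- exact: imB.
- by move=> n; case: (fv n) => [[]].
split=> //; rewrite /cintegral (complex_eta v); congr (_ +i* _).
  rewrite -(cvg_lim (@Rhausdorff R) cr); apply: cvg_lim => //.
  have -> : (fun n => Rintegral mu setT (fun t => complex.Re (f_ n t))) = fun=> complex.Re v.
    by apply/funext => n; case: (fv n) => _ <-.
  exact: cvg_cst.
rewrite -(cvg_lim (@Rhausdorff R) cj); apply: cvg_lim => //.
have -> : (fun n => Rintegral mu setT (fun t => complex.Im (f_ n t))) = fun=> complex.Im v.
  by apply/funext => n; case: (fv n) => _ <-.
exact: cvg_cst.
Qed.

(** Termwise integration of a series whose remainders, rather than terms, are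
    dominated: the n-th partial sum is [f] minus a remainder. *)
Lemma has_cintegral_series (e_ : nat -> R -> R[i]) (c_ : nat -> R[i]) f
    (r_ : nat -> R -> R[i]) (psi : R -> R) (v : R[i]) (K : R) :
  has_cintegral (e_ 0%N) v -> (forall k, has_cintegral (e_ k.+1) 0) ->
  (forall t, 0 <= psi t < 1) ->
  (forall n t, f t = \sum_(k < n) c_ k * e_ k t + r_ n t) ->
  (forall n t, nrm (r_ n t) <= K * lorentzian t * psi t ^+ n) ->
  has_cintegral f (c_ 0%N * v).
Proof.
move=> e0 eS psi01 fE rK.
have K0 t : 0 <= K * lorentzian t.
  by have := rK 0%N t; rewrite expr0 mulr1; apply: le_trans; exact: nrm_ge0.
apply: (@has_cintegral_dominated (fun n t => \sum_(k < n.+1) c_ k * e_ k t) _ _ (K *+ 2)).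
- elim=> [|n IH].
    by apply: eq_has_cintegral (has_cintegralZ (c_ 0%N) e0) => t; rewrite big_ord1.
  have -> : c_ 0%N * v = c_ 0%N * v + c_ n.+1 * 0 by rewrite mulr0 addr0.
  apply: eq_has_cintegral (has_cintegralD IH (has_cintegralZ _ (eS n))) => t.
  by rewrite [RHS]big_ord_recr.
- move=> n t; have -> : \sum_(k < n.+1) c_ k * e_ k t = f t - r_ n.+1 t.
    by rewrite (fE n.+1 t) addrK.
  apply: le_trans (nrmD _ _) _; rewrite nrmN mulrnAl mulr2n lerD//.
    have := rK 0%N t; rewrite expr0 mulr1; congr (nrm _ <= _).
    by rewrite (fE 0%N t) big_ord0 add0r.
  apply: le_trans (rK _ _) _; rewrite ler_piMr// exprn_ile1//.
    by have /andP[] := psi01 t.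
  by have /andP[_ /ltW] := psi01 t.
move=> t; have -> : (fun n => nrm (f t - \sum_(k < n.+1) c_ k * e_ k t)) =
    (fun n => nrm (r_ n.+1 t)).
  by apply/funext => n; rewrite (fE n.+1 t) addrC addKr.
have /andP[p0 p1] := psi01 t.
apply: (@squeeze_cvgr _ _ _ _ (fun=> 0) (fun n => K * lorentzian t * psi t ^+ n.+1)).
- by apply: nearW => n; rewrite nrm_ge0 rK.
- exact: cvg_cst.
- rewrite -[X in _ --> X](mulr0 (K * lorentzian t)); apply: cvgM; first exact: cvg_cst.
  rewrite (cvg_shiftS (fun n => psi t ^+ n)).
  by apply: cvg_expr; rewrite ger0_norm.
Qed.

End ComplexIntegral.

(** * Integrals of rational functions over a vertical line *)

Section VerticalLine.
Variable R : realType.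
Implicit Types (f g : R -> R[i]) (t : R) (c : R).

(** [R[i]] is normed over itself, hence the derivative in a real variable is taken
    componentwise. *)
Definition is_cderive f f' := forall t : R,
  is_derive t 1 (fun s => complex.Re (f s)) (complex.Re (f' t)) /\
  is_derive t 1 (fun s => complex.Im (f s)) (complex.Im (f' t)).

Lemma is_cderive_cst (a : R[i]) : is_cderive (fun=> a) (fun=> 0).
Proof. by move=> t; split; exact: is_derive_cst. Qed.

Lemma is_cderiveD f g f' g' : is_cderive f f' -> is_cderive g g' ->
  is_cderive (fun t => f t + g t) (fun t => f' t + g' t).
Proof.
move=> df dg t; have [rf jf] := df t; have [rg jg] := dg t; split.
  under eq_fun do rewrite reD; rewrite reD; exact: is_deriveD.
under eq_fun do rewrite imD; rewrite imD; exact: is_deriveD.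
Qed.

Lemma is_cderiveM f g f' g' : is_cderive f f' -> is_cderive g g' ->
  is_cderive (fun t => f t * g t) (fun t => f' t * g t + f t * g' t).
Proof.
move=> df dg t; have [rf jf] := df t; have [rg jg] := dg t; split.
  under eq_fun do rewrite reM.
  have h := is_deriveB (is_deriveM rf rg) (is_deriveM jf jg).
  apply: (is_derive_eq h).
  rewrite reD !reM /GRing.scale /=; ring.
under eq_fun do rewrite imM.
have h := is_deriveD (is_deriveM rf jg) (is_deriveM jf rg).
apply: (is_derive_eq h).
rewrite imD !imM /GRing.scale /=; ring.
Qed.

Lemma is_cderive_eq f f' g' : is_cderive f f' -> f' =1 g' -> is_cderive f g'.
Proof. by move=> df /funext <-. Qed.

Lemma is_cderiveZ (a : R[i]) f f' : is_cderive f f' ->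
  is_cderive (fun t => a * f t) (fun t => a * f' t).
Proof.
move=> df; apply: is_cderive_eq (is_cderiveM (is_cderive_cst a) df) _ => t.
by rewrite mul0r add0r.
Qed.

Lemma is_cderiveX f f' n : is_cderive f f' ->
  is_cderive (fun t => f t ^+ n.+1) (fun t => n.+1%:R * (f t ^+ n * f' t)).
Proof.
move=> df; elim: n => [|n IH].
  by apply: is_cderive_eq df _ => t; rewrite expr0 !mul1r.
have -> : (fun t => f t ^+ n.+2) = (fun t => f t * f t ^+ n.+1).
  by apply/funext => t; rewrite exprS.
apply: is_cderive_eq (is_cderiveM df IH) _ => t.
by rewrite [in RHS]mulrSr mulrDl mul1r addrC mulrCA -mulrCA !exprS; ring.
Qed.

Lemma cderive_continuous f f' : is_cderive f f' ->
  continuous (fun t => complex.Re (f t)) /\ continuous (fun t => complex.Im (f t)).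
Proof.
move=> df; split=> t; have [rf jf] := df t;
  by apply/differentiable_continuous/derivable1_diffP; apply: ex_derive.
Qed.

(** The points [z = c + i t] of the vertical line are only used through their
    inverses. *)
Definition line_inv c t : R[i] := (c +i* t)^-1.

Lemma line_invE c t : line_inv c t =
  (c / (c ^+ 2 + t ^+ 2)) +i* (- (t / (c ^+ 2 + t ^+ 2))).
Proof. by []. Qed.

Section NonZero.
Variable c : R.
Hypothesis c0 : c != 0.

Let den_gt0 t : 0 < c ^+ 2 + t ^+ 2.
Proof. by rewrite ltr_pwDl ?sqr_ge0// lt_neqAle sqr_ge0 eq_sym sqrf_eq0 c0. Qed.

Lemma line_neq0 t : c +i* t != 0.
Proof. by rewrite eq_complex /= (negPf c0). Qed.

Lemma is_derive_den t : is_derive t 1 (fun s : R => c ^+ 2 + s ^+ 2) (t *+ 2).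
Proof.
have h := is_deriveD (is_derive_cst (c ^+ 2) t 1) (is_deriveM (is_derive_id t 1) (is_derive_id t 1)).
apply: (is_derive_eq h).
by rewrite add0r /GRing.scale /= mulr1 mulr2n.
Qed.

Lemma is_cderive_line_inv :
  is_cderive (line_inv c) (fun t => - 'i * line_inv c t ^+ 2).
Proof.
move=> t; rewrite expr2 line_invE.
have dV := @is_deriveV _ (fun s => c ^+ 2 + s ^+ 2) t _ 1
  (lt0r_neq0 (den_gt0 t)) (is_derive_den t).
have n0 := lt0r_neq0 (den_gt0 t).
split.
  under eq_fun do rewrite line_invE /=.
  have h := is_deriveM (is_derive_cst c t 1) dV.
  apply: (is_derive_eq h).
  rewrite /GRing.scale /=; field.
  by [].
under eq_fun do rewrite line_invE /=.
have h := is_deriveN (is_deriveM (is_derive_id t 1) dV).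
apply: (is_derive_eq h).
rewrite /GRing.scale /=; field.
by [].
Qed.

Lemma nrm_line_inv_sqr t : nrm (line_inv c t) ^+ 2 = (c ^+ 2 + t ^+ 2)^-1.
Proof.
rewrite nrmV exprVn nrm_sqr /=.
by [].
Qed.

Lemma nrm_line_inv_lorentzian t :
  nrm (line_inv c t) ^+ 2 <= (1 + c ^- 2) * lorentzian t.
Proof.
rewrite nrm_line_inv_sqr /lorentzian ler_pdivlMr ?ltr_pwDl ?sqr_ge0//.
rewrite mulrC ler_pdivrMr//.
have -> : (1 + c ^- 2) * (c ^+ 2 + t ^+ 2) = (1 + t ^+ 2) + (c ^+ 2 + t ^+ 2 / c ^+ 2).
  by field.
by rewrite lerDl addr_ge0 ?divr_ge0 ?sqr_ge0.
Qed.

Lemma nrm_line_inv_le t : nrm (line_inv c t) <= `|c|^-1.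
Proof.
rewrite -(@ler_pXn2r _ 2)// ?nnegrE ?nrm_ge0 ?invr_ge0//.
rewrite nrm_line_inv_sqr exprVn real_normK ?num_real// lef_pV2 ?posrE//.
  by rewrite lerDl sqr_ge0.
by rewrite lt_neqAle sqr_ge0 eq_sym sqrf_eq0 c0.
Qed.

Lemma nrm_line_inv_le_imag t : t != 0 -> nrm (line_inv c t) <= `|t|^-1.
Proof.
move=> t0; rewrite -(@ler_pXn2r _ 2)// ?nnegrE ?nrm_ge0 ?invr_ge0//.
rewrite nrm_line_inv_sqr exprVn real_normK ?num_real// lef_pV2 ?posrE//.
  by rewrite lerDr sqr_ge0.
by rewrite lt_neqAle sqr_ge0 eq_sym sqrf_eq0 t0.
Qed.

End NonZero.

Lemma nrm_line_inv_prod c e t : c != 0 -> e != 0 ->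
  nrm (line_inv c t) * nrm (line_inv e t) <= (2 + c ^- 2 + e ^- 2) * lorentzian t.
Proof.
move=> c0 e0.
have h1 := nrm_line_inv_lorentzian c0 t; have h2 := nrm_line_inv_lorentzian e0 t.
have h3 := sqr_ge0 (nrm (line_inv c t) - nrm (line_inv e t)).
have h4 : 0 <= nrm (line_inv c t) * nrm (line_inv e t) by rewrite mulr_ge0 ?nrm_ge0.
have -> : (2 + c ^- 2 + e ^- 2) * lorentzian t =
  (1 + c ^- 2) * lorentzian t + (1 + e ^- 2) * lorentzian t by ring.
by nra.
Qed.

Lemma cvg0_le (u e : nat -> R) (C : R) :
  (forall n, `|u n| <= C * e n) -> e @ \oo --> (0 : R) -> u @ \oo --> (0 : R).
Proof.
move=> uC e0.
have Ce : (fun n => C * e n) @ \oo --> (0 : R).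
  by rewrite -[X in _ --> X](mulr0 C); apply: cvgM; [exact: cvg_cst|exact: e0].
apply: (@squeeze_cvgr _ _ _ _ (fun n => - (C * e n)) (fun n => C * e n)) => //.
  by apply: nearW => n; rewrite -ler_norml uC.
by rewrite -[X in _ --> X]oppr0; exact: cvgN.
Qed.

Lemma nrm_subX (a b : R[i]) (B : R) m : nrm a <= B -> nrm b <= B ->
  nrm (a ^+ m.+1 - b ^+ m.+1) <= m.+1%:R * B ^+ m * nrm (a - b).
Proof.
move=> aB bB; have B0 : 0 <= B by exact: le_trans (nrm_ge0 _) aB.
elim: m => [|m IH]; first by rewrite !expr1 expr0 !mul1r.
have -> : a ^+ m.+2 - b ^+ m.+2 = a * (a ^+ m.+1 - b ^+ m.+1) + (a - b) * b ^+ m.+1.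
  by rewrite !exprS; ring.
apply: le_trans (nrmD _ _) _; rewrite !nrmM nrmX.
have h1 : nrm a * nrm (a ^+ m.+1 - b ^+ m.+1) <= B * (m.+1%:R * B ^+ m * nrm (a - b)).
  by rewrite ler_pM ?nrm_ge0.
have h2 : nrm (a - b) * nrm b ^+ m.+1 <= nrm (a - b) * B ^+ m.+1.
  by rewrite ler_wpM2l ?nrm_ge0// lerXn2r ?nnegrE ?nrm_ge0.
apply: le_trans (lerD h1 h2) _.
by rewrite le_eqVlt; apply/orP; left; apply/eqP; rewrite !exprS -[in RHS]natr1; ring.
Qed.

(** The fundamental theorem of calculus for the powers of a function that has the
    same limit at both ends of the line. *)
Lemma has_cintegral_power f f' f'' (B K : R) m : is_cderive f f' ->
  is_cderive f' f'' -> (forall t, nrm (f t) <= B) ->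
  (forall t, nrm (f' t) <= K * lorentzian t) ->
  (fun n => nrm (f n.+1%:R - f (- n.+1%:R))) @ \oo --> (0 : R) ->
  has_cintegral (fun t => f t ^+ m * f' t) 0.
Proof.
move=> df df' fB f'K f0.
have B0 : 0 <= B by exact: le_trans (nrm_ge0 _) (fB 0).
pose g t := f t ^+ m * f' t; pose G t := m.+1%:R^-1 * f t ^+ m.+1.
have dG : is_cderive G g.
  apply: is_cderive_eq (is_cderiveZ _ (is_cderiveX m df)) _ => t.
  by rewrite mulrA mulVf ?mul1r// pnatr_eq0.
have [h dg] : exists h, is_cderive g h.
  rewrite /g; case: (m) => [|k].
    by eexists; under eq_fun do rewrite expr0 mul1r; exact: df'.
  by eexists; exact: is_cderiveM (is_cderiveX k df) df'.
have [cr cj] := cderive_continuous dg.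
have gK t : nrm (g t) <= B ^+ m * K * lorentzian t.
  rewrite nrmM nrmX -mulrA ler_pM ?exprn_ge0 ?nrm_ge0//.
  by rewrite lerXn2r ?nnegrE ?nrm_ge0.
have G0 n : nrm (G n.+1%:R - G (- n.+1%:R)) <=
    B ^+ m * nrm (f n.+1%:R - f (- n.+1%:R)).
  rewrite /G -mulrBr nrmM -(rmorph_nat (real_complex R)) -fmorphV nrmC.
  rewrite ger0_norm ?invr_ge0 ?ler0n// ler_pdivrMl ?ltr0n// mulrA.
  exact: nrm_subX.
have [ir vr] : lebesgue_measure.-integrable setT (EFin \o (fun t => complex.Re (g t)))
    /\ Rintegral lebesgue_measure setT (fun t => complex.Re (g t)) = 0.
  apply: (@line_FTC _ _ (fun t => complex.Re (G t)) (B ^+ m * K)) => //.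
  - by move=> t; have [] := dG t.
  - by move=> t; exact: le_trans (nrm_Re _) (gK t).
  apply: (cvg0_le (C := B ^+ m) (e := fun n => nrm (f n.+1%:R - f (- n.+1%:R)))) => // n.
  by rewrite -reB; exact: le_trans (nrm_Re _) (G0 n).
have [ij vj] : lebesgue_measure.-integrable setT (EFin \o (fun t => complex.Im (g t)))
    /\ Rintegral lebesgue_measure setT (fun t => complex.Im (g t)) = 0.
  apply: (@line_FTC _ _ (fun t => complex.Im (G t)) (B ^+ m * K)) => //.
  - by move=> t; have [] := dG t.
  - by move=> t; exact: le_trans (nrm_Im _) (gK t).
  apply: (cvg0_le (C := B ^+ m) (e := fun n => nrm (f n.+1%:R - f (- n.+1%:R)))) => // n.
  by rewrite -imB; exact: le_trans (nrm_Im _) (G0 n).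
by split=> //; rewrite /cintegral vr vj.
Qed.

Section Poles.
Variable c : R.
Hypothesis c0 : c != 0.

Lemma nrmi : nrm ('i : R[i]) = 1.
Proof. by rewrite /nrm normc_def /= expr0n add0r expr1n sqrtr1. Qed.

Lemma line_inv_ends : (fun n => nrm (line_inv c n.+1%:R - line_inv c (- n.+1%:R)))
  @ \oo --> (0 : R).
Proof.
apply: (cvg0_le (C := 2) (e := fun n => n.+1%:R^-1)); last exact: cvg_harmonic.
move=> n; rewrite ger0_norm ?nrm_ge0//.
apply: le_trans (nrmD _ _) _; rewrite nrmN mulr_natl mulr2n.
have n0 : n.+1%:R != 0 :> R by rewrite pnatr_eq0.
have h1 := nrm_line_inv_le_imag c0 n0.
have h2 : nrm (line_inv c (- n.+1%:R)) <= `|- n.+1%:R|^-1.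
  by apply: (nrm_line_inv_le_imag c0); rewrite oppr_eq0.
by rewrite normrN in h2; rewrite !ger0_norm// in h1 h2; rewrite lerD.
Qed.

(** Vertical lines are mapped by Moebius transformations to closed curves, along
    which powers have a single-valued primitive. *)
Lemma has_cintegral_moebius (b a : R[i]) m : a != 0 ->
  has_cintegral (fun t => (b + a * line_inv c t) ^+ m * line_inv c t ^+ 2) 0.
Proof.
move=> a0; have dinv := is_cderive_line_inv c0.
pose f t := b + a * line_inv c t; pose f' t := a * (- 'i * line_inv c t ^+ 2).
have df : is_cderive f f'.
  apply: is_cderive_eq (is_cderiveD (is_cderive_cst b) (is_cderiveZ a dinv)) _ => t.
  by rewrite add0r.
have df' := is_cderiveZ a (is_cderiveZ (- 'i) (is_cderiveX 1 dinv)).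
have h : has_cintegral (fun t => f t ^+ m * f' t) 0.
  apply: (@has_cintegral_power _ _ _ (nrm b + nrm a * `|c|^-1)
    (nrm a * (1 + c ^- 2)) m df df').
  - move=> t; apply: le_trans (nrmD _ _) _; rewrite lerD// nrmM.
    by rewrite ler_wpM2l ?nrm_ge0// nrm_line_inv_le.
  - move=> t; rewrite /f' nrmM (nrmM (- 'i)) nrmN nrmi mul1r nrmX -mulrA.
    by rewrite ler_wpM2l ?nrm_ge0// nrm_line_inv_lorentzian.
  apply: (cvg0_le (C := nrm a) _ line_inv_ends) => n.
  by rewrite ger0_norm ?nrm_ge0// /f opprD addrACA subrr add0r -mulrBr nrmM.
have := has_cintegralZ ('i / a) h.
rewrite mulr0; apply: eq_has_cintegral => t; rewrite /f /f'.
have ii : 'i * 'i = -1 :> R[i] by rewrite -expr2 sqr_i.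
set p := _ ^+ m; set q := _ ^+ 2.
transitivity (- ('i * 'i) * (a^-1 * a) * (p * q)); first by ring.
by rewrite ii opprK mulVf// !mul1r.
Qed.

Lemma has_cintegral_line_inv m : has_cintegral (fun t => line_inv c t ^+ m.+2) 0.
Proof.
apply: eq_has_cintegral (has_cintegral_moebius 0 m (oner_neq0 _)) => t.
by rewrite add0r mul1r -exprD addn2.
Qed.

End Poles.

Lemma cvg_atan_line (c : R) : 0 < c ->
  (fun n => atan (n.+1%:R / c)) @ \oo --> pi / 2.
Proof.
move=> c0; have nat_cvgy : (fun n => n.+1%:R / c) @ \oo --> +oo%R.
  rewrite (cvg_shiftS (fun n => n%:R / c)); apply/cvgryPge => A.
  by apply: filterS (cvgry_ge cvgr_idn (A * c)) => n; rewrite ler_pdivlMr.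
exact: (cvg_comp _ _ nat_cvgy (@cvgy_atan R)).
Qed.

Lemma is_derive_atan_line (c t : R) : c != 0 ->
  is_derive t 1 (fun s : R => atan (s / c)) (c / (c ^+ 2 + t ^+ 2)).
Proof.
move=> c0.
have h := @is_derive1_comp _ (@atan R) (fun s => s / c) t _ _
  (is_derive1_atan (t / c)) (is_deriveM (is_derive_id t 1) (is_derive_cst c^-1 t 1)).
apply: (is_derive_eq h).
have d0 : c ^+ 2 + t ^+ 2 != 0.
  by rewrite lt0r_neq0// ltr_pwDl ?sqr_ge0// lt_neqAle sqr_ge0 eq_sym sqrf_eq0 c0.
rewrite /GRing.scale /= mulr0 add0r; field.
by rewrite d0 c0.
Qed.

Lemma is_derive_ln_line (c t : R) : c != 0 ->
  is_derive t 1 (fun s : R => ln (c ^+ 2 + s ^+ 2)) (t *+ 2 / (c ^+ 2 + t ^+ 2)).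
Proof.
move=> c0.
have d0 : 0 < c ^+ 2 + t ^+ 2.
  by rewrite ltr_pwDl ?sqr_ge0// lt_neqAle sqr_ge0 eq_sym sqrf_eq0 c0.
have h := @is_derive1_comp _ (@ln R) (fun s => c ^+ 2 + s ^+ 2) t _ _
  (is_derive1_ln d0) (is_derive_den c t).
by apply: (is_derive_eq h); rewrite mulrC.
Qed.

(** The vertical line separates the two poles, so that both contribute half a
    turn. *)
Lemma has_cintegral_poles (d e : R) : 0 < d -> 0 < e ->
  has_cintegral (fun t => line_inv d t - line_inv (- e) t) (2 * pi)%:C.
Proof.
move=> d_gt0 e_gt0; have d0 := lt0r_neq0 d_gt0; have e0 := lt0r_neq0 e_gt0.
have ne0 : - e != 0 by rewrite oppr_eq0.
pose g t := line_inv d t - line_inv (- e) t.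
pose K := (d + e) * (2 + d ^- 2 + (- e) ^- 2).
have gK t : nrm (g t) <= K * lorentzian t.
  have -> : g t = (- (d + e))%:C * (line_inv d t * line_inv (- e) t).
    rewrite /g /line_inv.
    have -> : (- (d + e))%:C = (- e +i* t) - (d +i* t) :> R[i].
      by apply/eqP; rewrite eq_complex /= subrr eqxx opprD addrC eqxx.
    have := line_neq0 d0 t; have := line_neq0 ne0 t.
    by move: (d +i* t) (- e +i* t) => z z' z0 z'0; field; rewrite z0.
  have de0 : 0 <= d + e by rewrite addr_ge0 ?ltW.
  rewrite nrmM nrmC normrN (ger0_norm de0) nrmM /K -[leRHS]mulrA.
  by rewrite ler_wpM2l//; exact: nrm_line_inv_prod.
have dg : is_cderive g (fun t => - 'i * line_inv d t ^+ 2 +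
    -1 * (- 'i * line_inv (- e) t ^+ 2)).
  have := is_cderiveD (is_cderive_line_inv d0) (is_cderiveZ (-1) (is_cderive_line_inv ne0)).
  by under eq_fun do rewrite mulN1r.
have [cr cj] := cderive_continuous dg.
have [ir vr] : lebesgue_measure.-integrable setT (EFin \o (fun t => complex.Re (g t)))
    /\ Rintegral lebesgue_measure setT (fun t => complex.Re (g t)) = 2 * pi.
  apply: (@line_FTC _ _ (fun t => atan (t / d) + atan (t / e)) K) => //.
  - move=> t; have h := is_deriveD (is_derive_atan_line t d0) (is_derive_atan_line t e0).
    apply: (is_derive_eq h).
    by rewrite /g reB !line_invE /= sqrrN mulNr opprK.
  - by move=> t; exact: le_trans (nrm_Re _) (gK t).
  have -> : 2 * pi = (pi / 2 + pi / 2) + (pi / 2 + pi / 2) :> R by field.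
  under eq_fun do rewrite !mulNr !atanN opprD !opprK.
  apply: cvgD; apply: cvgD; exact: cvg_atan_line.
have [ij vj] : lebesgue_measure.-integrable setT (EFin \o (fun t => complex.Im (g t)))
    /\ Rintegral lebesgue_measure setT (fun t => complex.Im (g t)) = 0.
  apply: (@line_FTC _ _ (fun t => 2^-1 * ln (e ^+ 2 + t ^+ 2) - 2^-1 * ln (d ^+ 2 + t ^+ 2)) K) => //.
  - move=> t.
    have h := is_deriveB
      (is_deriveM (is_derive_cst (2^-1 : R) t 1) (is_derive_ln_line t e0))
      (is_deriveM (is_derive_cst (2^-1 : R) t 1) (is_derive_ln_line t d0)).
    apply: (is_derive_eq h).
    rewrite /g imB !line_invE /= sqrrN /GRing.scale /= !mulr0 !addr0 opprK.
    rewrite !mulr2n; field.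
    by rewrite !lt0r_neq0// ltr_pwDl ?sqr_ge0// exprn_gt0.
  - by move=> t; exact: le_trans (nrm_Im _) (gK t).
  under eq_fun do rewrite sqrrN subrr; exact: cvg_cst.
by split=> //; rewrite /cintegral vr vj.
Qed.

End VerticalLine.

(** * Integrals of resolvents over a vertical line *)

Section ResolventIntegrals.
Variables (R : realType) (H : completeNormedModType R[i]).
Variable dot : {dot H for Num.conj}.
Hypothesis dotE : hilbert_norm dot.
Variables (V : set H) (A : operator H).
Hypotheses (clV : closed_subspace V) (saA : selfadjoint dot V A).
Let subV : linear_subspace V. Proof. by case: clV => _ /submod_subspace. Qed.

Variables (L : H -> R[i]) (C : R).
Hypotheses (Llin : forall a x y, V x -> V y -> L (a *: x + y) = a * L x + L y)
  (C0 : 0 <= C) (LC : forall x, V x -> nrm (L x) <= C * nrm x).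

Variable d : R.
Hypothesis d_gt0 : 0 < d.
Let d0 : d != 0. Proof. exact: lt0r_neq0. Qed.

Let lineV t : line_inv d t * (d +i* t) = 1.
Proof. by rewrite mulVf// line_neq0. Qed.

Section Gap.
Variable delta : R.
Hypotheses (delta0 : 0 < delta) (gap : numerical_gap dot A d delta).

Let r t x := resolvent A (d +i* t) x.
Let Kres := d / delta + 1.

Let rP t x : V x -> opdom A (r t x) /\ A (r t x) - (d +i* t) *: r t x = x.
Proof. exact: (resolventP dotE clV saA delta0 gap). Qed.

Let rV t x : V x -> V (r t x).
Proof. by move=> /(rP t)[/(sa_dom_sub saA)]. Qed.

Let r_decay t x : V x -> nrm (r t x) <= Kres * nrm x * nrm (line_inv d t).
Proof.
move=> Vx; have := resolvent_decay dotE clV saA delta0 gap t Vx.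
rewrite (ger0_norm (ltW d_gt0)) -/Kres nrmV => h.
rewrite ler_pdivlMr; first by rewrite mulrC.
rewrite lt_neqAle nrm_ge0 andbT eq_sym; apply/eqP => /nrm_eq0/eqP.
by rewrite (negPf (line_neq0 d0 t)).
Qed.

Let Kres_ge0 : 0 <= Kres.
Proof. by rewrite addr_ge0// divr_ge0 ?ltW. Qed.

(** As |A| < d <= |z| on the whole line, A (A - z)^-1 is minus the sum of the terms
    A^k z^(- k) for k >= 1.  Division by z leaves powers of 1 / z of order at least
    two, whose integrals vanish. *)
Lemma has_cintegral_resolvent_outside (m : R) (u : H) :
  (forall x, V x -> opdom A x) -> 0 <= m -> m < d ->
  (forall x, V x -> nrm (A x) <= m * nrm x) -> V u ->
  has_cintegral (fun t => L (A (r t u)) * line_inv d t) 0.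
Proof.
move=> domA m0 md Am Vu.
have AV x : V x -> V (A x) by move=> Vx; apply: (sa_range saA); exact: domA.
have iterV n x : V x -> V (iter n A x) by move=> Vx; elim: n => //= n; exact: AV.
have iterD n a x y : V x -> V y -> iter n A (a *: x + y) = a *: iter n A x + iter n A y.
  move=> Vx Vy; elim: n => //= n ->.
  by rewrite (sa_linear saA)//; apply: domA; exact: iterV.
have iter_bound n x : V x -> nrm (iter n A x) <= m ^+ n * nrm x.
  move=> Vx; elim: n => [|n IH] /=; first by rewrite mul1r.
  apply: le_trans (Am _ (iterV n _ Vx)) _.
  by rewrite exprS -mulrA ler_wpM2l.
pose rem n t := L (iter n.+1 A (r t u)) * line_inv d t ^+ n.+1.
pose coef k := - L (iter k.+1 A u).
have remS n t : rem n t = coef n * line_inv d t ^+ n.+2 + rem n.+1 t.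
  have [dr rE] := rP t Vu; have Vr := rV t Vu.
  have ArE : A (r t u) = (d +i* t) *: r t u + u by move/eqP: rE; rewrite subr_eq addrC => /eqP.
  rewrite /rem /coef (iterSr n.+1) ArE iterD// Llin; try exact: iterV.
  rewrite [line_inv d t ^+ n.+2]exprS.
  transitivity (line_inv d t * (d +i* t) * (L (iter n.+1 A (r t u)) * line_inv d t ^+ n.+1)).
    by rewrite lineV mul1r.
  by ring.
rewrite -(mulr0 (coef 0%N)).
apply: (@has_cintegral_series _ (fun k t => line_inv d t ^+ k.+2) coef _ rem
  (fun t => m * nrm (line_inv d t)) 0 (C * m * (Kres * nrm u) * (1 + d ^- 2))).
- exact: has_cintegral_line_inv.
- by move=> k; exact: has_cintegral_line_inv.
- move=> t; rewrite mulr_ge0 ?nrm_ge0//=.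
  apply: (@le_lt_trans _ _ (m * `|d|^-1)); first by rewrite ler_wpM2l// nrm_line_inv_le.
  by rewrite gtr0_norm// ltr_pdivrMr// mul1r.
- elim=> [|n IH] t; first by rewrite big_ord0 add0r /rem expr1.
  by rewrite big_ord_recr /= -addrA -remS -IH.
move=> n t; rewrite /rem nrmM nrmX.
have Vr := rV t Vu.
have h1 : nrm (L (iter n.+1 A (r t u))) <= C * (m ^+ n.+1 * (Kres * nrm u * nrm (line_inv d t))).
  apply: le_trans (LC (iterV n.+1 _ Vr)) _; rewrite ler_wpM2l//.
  apply: le_trans (iter_bound n.+1 _ Vr) _; rewrite ler_wpM2l ?exprn_ge0//.
  exact: r_decay.
apply: le_trans (ler_wpM2r _ h1) _; first by rewrite exprn_ge0 ?nrm_ge0.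
have h2 := nrm_line_inv_lorentzian d0 t.
set w := nrm (line_inv d t) in h2 *.
have w0 : 0 <= w by exact: nrm_ge0.
have cf0 : 0 <= C * m * (Kres * nrm u) * (m * w) ^+ n.
  by rewrite !mulr_ge0 ?exprn_ge0 ?mulr_ge0 ?nrm_ge0.
have := ler_wpM2l cf0 h2; congr (_ <= _); rewrite ?exprMn ?exprS; ring.
Qed.

(** The Moebius map phi = z / (z - 2 e) sends the line into the unit disk and turns
    the resolvent into a geometric series in the contraction W = 1 - 2 e A^-1.  On
    the line [|phi|] tends to 1, but the remainder phi^n W^n (A - z)^-1 is never
    larger than the resolvent bound allows. *)
Lemma has_cintegral_resolvent_inside (e : R) (x0 : H) :
  d < e -> form_lower dot A e -> V x0 ->
  has_cintegral (fun t => L (r t x0) * line_inv d t) (L (opinv A x0) * (2 * pi)%:C).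
Proof.
move=> de low Vx0.
have e_gt0 : 0 < e by exact: lt_trans de.
pose B := opinv A.
have BV x : V x -> V (B x) by exact: pd_invV low x.
pose W y := y - (2 * e)%:C *: B y.
have WV x : V x -> V (W x).
  by move=> Vx; apply: (subspaceB subV) => //; apply: (subspaceZ subV); exact: BV.
have Wlin : linear_on V W.
  move=> a x y Vx Vy; rewrite /W (pd_inv_linear dotE clV saA e_gt0 low)//.
  by rewrite scalerDr scalerBr !scalerA (mulrC a) opprD addrACA.
have Wc x : V x -> nrm (W x) <= nrm x.
  by move=> Vx; apply: (pd_contraction dotE clV saA e_gt0 low) => //; rewrite ?mulr_ge0// ltW.
have iterV n x : V x -> V (iter n W x) by move=> Vx; elim: n => //= n; exact: WV.
have iterD n a x y : V x -> V y -> iter n W (a *: x + y) = a *: iter n W x + iter n W y.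
  by move=> Vx Vy; elim: n => //= n ->; rewrite Wlin//; exact: iterV.
have iter_bound n x : V x -> nrm (iter n W x) <= nrm x.
  by move=> Vx; elim: n => //= n; apply: le_trans; apply: Wc; exact: iterV.
(* c + i t = z - 2 e is the line seen from the pole of the Moebius map. *)
pose c := - (2 * e - d).
have c0 : c != 0 by rewrite oppr_eq0 lt0r_neq0// subr_gt0; lra.
pose phi t := 1 + (2 * e)%:C * line_inv c t.
have lineVc t : line_inv c t * (c +i* t) = 1 by rewrite mulVf// line_neq0.
have dcE t : d +i* t = (c +i* t) + (2 * e)%:C.
  by apply/eqP; rewrite eq_complex /= addr0 eqxx andbT /c; apply/eqP; ring.
have phiE t : phi t = (d +i* t) * line_inv c t.
  by rewrite dcE mulrDl mulrC lineVc.
have phi_w t : phi t * line_inv d t = line_inv c t.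
  by rewrite phiE mulrAC [_ * line_inv d t]mulrC lineV mul1r.
have phi1 t : 1 - phi t = (- (2 * e))%:C * line_inv c t.
  by rewrite /phi opprD addrA subrr add0r rmorphN mulNr.
pose rem n t := phi t ^+ n * L (iter n W (r t x0)) * line_inv d t.
(* (1 - phi) phi^k / z is 1 / z - 1 / (z - 2 e) for k = 0, and for k > 0 a multiple
   of phi^(k - 1) / (z - 2 e)^2, because phi / z = 1 / (z - 2 e). *)
pose coef k := L (iter k W (B x0)) * (if k is 0%N then 1 else (- (2 * e))%:C).
pose term k t := if k is j.+1 then phi t ^+ j * line_inv c t ^+ 2
  else line_inv d t - line_inv c t.
have remS n t : rem n t = coef n * term n t + rem n.+1 t.
  have [dr rE] := rP t Vx0; have Vr := rV t Vx0; have VB := BV _ Vx0.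
  have ArE : A (r t x0) = (d +i* t) *: r t x0 + x0 by move/eqP: rE; rewrite subr_eq addrC => /eqP.
  have BrE : r t x0 = (d +i* t) *: B (r t x0) + B x0.
    by rewrite -(pd_inv_linear dotE clV saA e_gt0 low)// -ArE (pd_invK dotE saA e_gt0 low dr).
  have rE2 : r t x0 = (1 - phi t) *: (-1 *: W (r t x0) + B x0) + W (r t x0).
    have -> : -1 *: W (r t x0) + B x0 = - (c +i* t) *: B (r t x0).
      rewrite scaleN1r opprB [X in _ - X + _]BrE opprD addrA subrK -scalerBl dcE.
      by congr (_ *: _); ring.
    by rewrite scalerA phi1 mulrN -mulrA lineVc mulr1 rmorphN opprK /W addrC subrK.
  have LE : L (iter n W (r t x0)) = (1 - phi t) * L (iter n W (B x0)) +
      phi t * L (iter n.+1 W (r t x0)).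
    rewrite {1}rE2 !iterD; try exact: WV; try exact: VB.
      rewrite -iterSr !Llin; try exact: (iterV n); try exact: (iterV n.+1).
        ring.
      by apply: subV.2; [exact: (iterV n.+1)|exact: iterV].
    by apply: subV.2; [exact: WV|exact: VB].
  rewrite /rem LE /coef /term.
  case: n {LE} => [|j].
    have := phi_w t; set l := L _; set l' := L _ => pw.
    transitivity (l * (line_inv d t - phi t * line_inv d t) + phi t * line_inv d t * l').
      by rewrite expr0; ring.
    by rewrite pw expr1 mulr1 [phi t * l']mulrC -mulrA pw [l' * _]mulrC.
  rewrite phi1.
  set l := L _; set l' := L _; rewrite mulrDr mulrDl; congr (_ + _); last by rewrite !exprSr; ring.
  transitivity (l * (- (2 * e))%:C * (phi t ^+ j * line_inv c t * (phi t * line_inv d t))).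
    by rewrite !exprSr; ring.
  by rewrite phi_w; ring.
have -> : L (opinv A x0) * (2 * pi)%:C = coef 0%N * (2 * pi)%:C.
  by rewrite /coef /= mulr1.
apply: (@has_cintegral_series _ term coef _ rem (fun t => nrm (phi t)) _
  (C * (Kres * nrm x0) * (1 + d ^- 2))).
- have := @has_cintegral_poles R d (2 * e - d) d_gt0.
  by apply; rewrite subr_gt0; lra.
- move=> k; apply: has_cintegral_moebius => //.
  by rewrite eq_complex /= eqxx andbT mulf_neq0// lt0r_neq0.
- move=> t; rewrite nrm_ge0/= phiE nrmM.
  have ced : d < 2 * e - d by move: de d_gt0; lra.
  have cd : d ^+ 2 < c ^+ 2.
    by rewrite /c sqrrN ltr_pXn2r ?nnegrE//; [exact: ltW|apply: le_trans (ltW ced); exact: ltW].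
  rewrite -(@ltr_pXn2r _ 2)// ?nnegrE ?mulr_ge0 ?nrm_ge0// expr1n exprMn.
  rewrite nrm_line_inv_sqr nrm_sqr /= ltr_pdivrMr ?mul1r ?ltrD2r//.
  by rewrite ltr_wpDr ?sqr_ge0// lt_neqAle sqr_ge0 eq_sym sqrf_eq0 c0.
- elim=> [|n IH] t; first by rewrite big_ord0 add0r /rem expr0 mul1r.
  by rewrite big_ord_recr /= -addrA -remS -IH.
move=> n t; rewrite /rem !nrmM nrmX.
have Vr := rV t Vx0.
have h1 : nrm (L (iter n W (r t x0))) <= C * (Kres * nrm x0 * nrm (line_inv d t)).
  apply: le_trans (LC (iterV n _ Vr)) _; rewrite ler_wpM2l//.
  by apply: le_trans (iter_bound n _ Vr) _; exact: r_decay.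
have h2 := nrm_line_inv_lorentzian d0 t.
set w := nrm (line_inv d t) in h1 h2 *; set p := nrm (phi t).
have w0 : 0 <= w by exact: nrm_ge0.
have p0 : 0 <= p ^+ n by rewrite exprn_ge0 ?nrm_ge0.
apply: le_trans (ler_wpM2r w0 (ler_wpM2l p0 h1)) _.
have cf0 : 0 <= C * (Kres * nrm x0) * p ^+ n by rewrite !mulr_ge0 ?nrm_ge0.
have := ler_wpM2l cf0 h2; congr (_ <= _); ring.
Qed.

End Gap.

End ResolventIntegrals.

(** * The fixed-point equation T = G + B T M *)

Section FixedPoint.
Variables (R : realType) (H : completeNormedModType R[i]).
Variables (V W : set H) (G B M : H -> H) (g b m : R).
Hypotheses (subV : linear_subspace V) (clW : closed W) (subW : linear_subspace W).
Hypotheses (GP : bounded_map V W G g) (BP : bounded_map W W B b)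
  (MP : bounded_map V V M m).
Hypotheses (g0 : 0 <= g) (b0 : 0 <= b) (m0 : 0 <= m) (bm1 : b * m < 1).

Let GV x : V x -> W (G x). Proof. by case: GP => + _ _; apply. Qed.
Let BV x : W x -> W (B x). Proof. by case: BP => + _ _; apply. Qed.
Let MV x : V x -> V (M x). Proof. by case: MP => + _ _; apply. Qed.
Let Glin : linear_on V G. Proof. by case: GP. Qed.
Let Blin : linear_on W B. Proof. by case: BP. Qed.
Let Mlin : linear_on V M. Proof. by case: MP. Qed.
Let Gle x : V x -> nrm (G x) <= g * nrm x. Proof. by case: GP => _ _; apply. Qed.
Let Ble x : W x -> nrm (B x) <= b * nrm x. Proof. by case: BP => _ _; apply. Qed.
Let Mle x : V x -> nrm (M x) <= m * nrm x. Proof. by case: MP => _ _; apply. Qed.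

Fixpoint fixpoint_iter n (u : H) : H :=
  if n is k.+1 then G u + B (fixpoint_iter k (M u)) else 0.

Let iterW n u : V u -> W (fixpoint_iter n u).
Proof.
elim: n u => [|n IH] u Vu /=; first exact: subspace0.
by apply: (subspaceD subW); [exact: GV|apply/BV/IH/MV].
Qed.

Let iter_linear n : linear_on V (fixpoint_iter n).
Proof.
elim: n => [|n IH] a x y Vx Vy /=; first by rewrite scaler0 addr0.
rewrite Glin// Mlin// IH; try exact: MV.
by rewrite Blin; [rewrite scalerDr addrACA|exact/iterW/MV|exact/iterW/MV].
Qed.

Let step n u : V u ->
  nrm (fixpoint_iter n.+1 u - fixpoint_iter n u) <= g * (b * m) ^+ n * nrm u.
Proof.
elim: n u => [|n IH] u Vu.
  by rewrite /= (linear_on0 subW Blin) addr0 subr0 expr0 mulr1 Gle.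
have Vm := MV Vu.
have -> : fixpoint_iter n.+2 u - fixpoint_iter n.+1 u =
    B (fixpoint_iter n.+1 (M u) - fixpoint_iter n (M u)).
  rewrite (linear_onB Blin); try exact: iterW.
  by rewrite [LHS]/= opprD addrACA subrr add0r.
apply: le_trans (Ble (subspaceB subW (iterW _ Vm) (iterW _ Vm))) _.
apply: le_trans (ler_wpM2l b0 (IH _ Vm)) _.
have c0 : 0 <= b * (g * (b * m) ^+ n) by rewrite !mulr_ge0 ?exprn_ge0 ?mulr_ge0.
rewrite mulrA; apply: le_trans (ler_wpM2l c0 (Mle Vu)) _.
by rewrite le_eqVlt; apply/orP; left; apply/eqP; rewrite exprS; ring.
Qed.

(** The partial sums of the series of [B^k G M^k] have increments of norm at most
    [g (b m)^n]. *)
Lemma fixpoint_exists : exists X K, [/\ 0 <= K, bounded_map V W X K &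
  forall u, V u -> X u = G u + B (X (M u))].
Proof.
have bm0 : 0 <= b * m by rewrite mulr_ge0.
have q0 : 0 < 1 - b * m by rewrite subr_gt0.
have q1 := ltW q0.
pose y n := - (g * (b * m) ^+ n / (1 - b * m)).
have y0 : y @ \oo --> (0 : R).
  apply: (cvg0_le (C := g / (1 - b * m)) (e := fun n => (b * m) ^+ n)); last first.
    by apply: cvg_expr; rewrite ger0_norm.
  move=> n; rewrite /y normrN ger0_norm ?divr_ge0 ?mulr_ge0 ?exprn_ge0//.
  by rewrite mulrAC lexx.
have yrate n u : V u -> nrm (fixpoint_iter n.+1 u - fixpoint_iter n u) <=
    (y n.+1 - y n) * nrm u.
  move=> Vu; apply: le_trans (step n Vu) _; rewrite ler_wpM2r ?nrm_ge0//.
  rewrite le_eqVlt; apply/orP; left; apply/eqP; rewrite /y exprS; field.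
  exact: lt0r_neq0.
have [X [XW Xlin Xrate]] := operator_limit subV clW y0 iterW iter_linear yrate.
exists X, (- y 0%N); split.
- by rewrite /y opprK divr_ge0 ?mulr_ge0 ?exprn_ge0.
- split=> // u Vu; have := Xrate 0%N u Vu; rewrite /= subr0 sub0r; exact.
move=> u Vu; apply/eqP; rewrite -subr_eq0; apply/eqP/nrm_eq0/eqP.
rewrite eq_le nrm_ge0 andbT.
have yS0 : (fun n => - y n.+1 - b * m * y n) @ \oo --> (0 : R).
  rewrite -[X in _ --> X](subr0 0) -{1}oppr0 -{2}(mulr0 (b * m)).
  apply: cvgB; last by apply: cvgM => //; exact: cvg_cst.
  by apply: cvgN; move: y0; rewrite -(cvg_shiftS y).
apply: (le_vanishing (C := nrm u) yS0) => n; have Vm := MV Vu.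
apply: le_trans (nrmBD (fixpoint_iter n.+1 u) _ _) _.
rewrite mulrC mulrBl; apply: lerD.
  by have := Xrate n.+1 u Vu; rewrite sub0r.
rewrite /= opprD addrACA subrr add0r -(linear_onB Blin); [|exact: iterW|exact: XW].
apply: le_trans (Ble (subspaceB subW (iterW n Vm) (XW _ Vm))) _; rewrite nrmB.
apply: le_trans (ler_wpM2l b0 (Xrate n _ Vm)) _.
have yn0 : 0 <= b * (0 - y n).
  by rewrite sub0r /y opprK mulr_ge0// divr_ge0 ?mulr_ge0 ?exprn_ge0.
rewrite mulrA; apply: le_trans (ler_wpM2l yn0 (Mle Vu)) _.
by rewrite le_eqVlt; apply/orP; left; apply/eqP; ring.
Qed.

(** The difference [D] of two solutions satisfies [D = B^n D M^n]. *)
Lemma fixpoint_unique X X' K K' :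
  bounded_map V W X K -> bounded_map V W X' K' ->
  (forall u, V u -> X u = G u + B (X (M u))) ->
  (forall u, V u -> X' u = G u + B (X' (M u))) ->
  forall u, V u -> X' u = X u.
Proof.
move=> [XW _ XK] [X'W _ XK'] XE XE' u Vu.
have diff n v : V v -> nrm (X' v - X v) <= (K' + K) * (b * m) ^+ n * nrm v.
  elim: n v => [|n IH] v Vv.
    apply: le_trans (nrmD _ _) _.
    by rewrite nrmN expr0 mulr1 mulrDl lerD ?XK ?XK'.
  have Vm := MV Vv.
  have -> : X' v - X v = B (X' (M v) - X (M v)).
    rewrite XE'// XE// (linear_onB Blin); [|exact: X'W|exact: XW].
    by rewrite opprD addrACA subrr add0r.
  apply: le_trans (Ble (subspaceB subW (X'W _ Vm) (XW _ Vm))) _.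
  apply: le_trans (ler_wpM2l b0 (IH _ Vm)) _.
  have KK0 : (K' + K) * nrm (M v) <= (K' + K) * (m * nrm v).
    have [v0|v0] := eqVneq (nrm v) 0.
      by rewrite (nrm_eq0 v0) (linear_on0 subV Mlin) !nrm0 !mulr0.
    have KK : 0 <= K' + K.
      rewrite -(pmulr_lge0 _ (_ : 0 < nrm v)); last by rewrite lt0r v0 nrm_ge0.
      rewrite mulrDl addr_ge0//; first exact: le_trans (nrm_ge0 _) (XK' _ Vv).
      exact: le_trans (nrm_ge0 _) (XK _ Vv).
    by rewrite ler_wpM2l// Mle.
  have bmn : 0 <= b * (b * m) ^+ n by rewrite mulr_ge0 ?exprn_ge0 ?mulr_ge0.
  have := ler_wpM2l bmn KK0; congr (_ <= _); rewrite ?exprS; ring.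
apply/eqP; rewrite -subr_eq0; apply/eqP/nrm_eq0/eqP; rewrite eq_le nrm_ge0 andbT.
have e0 : (fun n => (b * m) ^+ n) @ \oo --> (0 : R).
  by apply: cvg_expr; rewrite ger0_norm ?mulr_ge0.
apply: (le_vanishing (C := (K' + K) * nrm u) e0) => n.
by rewrite mulrAC diff.
Qed.

End FixedPoint.

(** * The Sylvester equation *)

Section Bounds.
Variables (R : realType) (H : completeNormedModType R[i]).
Implicit Types (U V W : set H).

Lemma bounded_map_comp U V W (f h : H -> H) (K K' : R) : 0 <= K ->
  bounded_map V W f K -> bounded_map U V h K' -> bounded_map U W (f \o h) (K * K').
Proof.
move=> K0 [fW flin fK] [hV hlin hK]; split=> [x Ux|a x y Ux Uy|x Ux] /=.
- by apply: fW; exact: hV.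
- by rewrite hlin// flin//; exact: hV.
by apply: le_trans (fK _ (hV _ Ux)) _; rewrite -mulrA ler_wpM2l// hK.
Qed.

Lemma bounded_operator_map V W T : bounded_operator V W T ->
  exists2 K : R, 0 <= K & (opnorm T = K%:E)%E /\ bounded_map V W T K.
Proof.
move=> [linT domT TW Tfin]; have T0 := opnorm_ge0 linT.
have TE : opnorm T = (fine (opnorm T))%:E by rewrite fineK// ge0_fin_numE.
exists (fine (opnorm T)); first exact: fine_ge0.
split=> //; split=> //; first by case: linT => _; rewrite domT.
by move=> x Vx; apply: opnorm_le => //; [rewrite -TE|rewrite domT].
Qed.

Lemma map_bounded_operator V W (f : H -> H) (K : R) : linear_subspace V -> 0 <= K ->
  bounded_map V W f K -> bounded_operator V W (Operator V f).
Proof.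
move=> subV K0 [fW flin fK]; split=> //.
  by split; [exact: subspace_submod|exact: flin].
by apply: (@le_lt_trans _ _ K%:E); [exact: opnorm_bound|exact: ltry].
Qed.

(** The constant [1 + k] stands in for the square root of [k], which it exceeds. *)
Lemma le_of_sqr_le (a k n : R) : 0 <= a -> 0 <= k -> 0 <= n ->
  a ^+ 2 <= k * n ^+ 2 -> a <= (1 + k) * n.
Proof.
move=> a0 k0 n0 h; rewrite -(@ler_pXn2r _ 2)// ?nnegrE ?mulr_ge0 ?addr_ge0//.
apply: le_trans h _; rewrite exprMn ler_wpM2r ?sqr_ge0//.
by rewrite sqrrD expr1n mul1r; nra.
Qed.

(** If [b = 0], its inverse is infinite and any [e] beyond [d] will do; otherwise
    [e = 1 / b]. *)
Lemma lt_inve_real (b : \bar R) (d : R) : (0 <= b)%E -> 0 < d ->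
  (d%:E < b^-1)%E -> exists2 e, d < e & (b <= e^-1%:E)%E.
Proof.
move=> b0 d0; case: inveP b0 => [_ _|_|//|r r0 rge0].
- by exists (d + 1); rewrite ?ltrDl// lee_fin invr_ge0 addr_ge0// ltW.
- by rewrite lte_fin ltNge (ltW d0).
- rewrite lte_fin => dr; exists r^-1 => //; by rewrite invrK.
Qed.

Lemma real_between (x y : \bar R) : (0 <= x)%E -> (x < y)%E ->
  exists d : R, (x < d%:E)%E /\ (d%:E < y)%E.
Proof.
case: x => [x| |]// _; last by rewrite ltNge leey.
case: y => [y| |]//; last by exists (x + 1); rewrite lte_fin ltrDl ltr01 ltry.
by rewrite lte_fin => xy; exists ((x + y) / 2); rewrite !lte_fin midf_lt//= midf_lt.
Qed.

End Bounds.

Section Sylvester.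
Variables (R : realType) (H : completeNormedModType R[i]).
Variable dot : {dot H for Num.conj}.
Variables (HA HM : set H) (A M F : operator H).
Hypothesis dotE : hilbert_norm dot.
Hypotheses (clA : closed_subspace HA) (clM : closed_subspace HM).
Hypotheses (pdA : positive_definite dot HA A) (pdM : positive_definite dot HM M).
Hypotheses (bF : bounded_operator HM HA F) (bM : bounded_operator HM HM M).

Let subA : linear_subspace HA. Proof. by case: clA => _ /submod_subspace. Qed.
Let subM : linear_subspace HM. Proof. by case: clM => _ /submod_subspace. Qed.
Let saA : selfadjoint dot HA A. Proof. by case: pdA. Qed.
Let saM : selfadjoint dot HM M. Proof. by case: pdM. Qed.

Let domM x : HM x -> opdom M x. Proof. by case: bM => _ ->. Qed.
Let MV x : HM x -> HM (M x). Proof. by case: bM => _ _ + _; apply. Qed.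
Let FV x : HM x -> HA (F x). Proof. by case: bF => _ _ + _; apply. Qed.
Let Flin : linear_on HM F. Proof. by case: bF => -[_ lF] dF _ _ a x y Vx Vy; apply: lF; rewrite dF. Qed.
Let Mlin : linear_on HM M. Proof. by case: bM => -[_ lM] dM _ _ a x y Vx Vy; apply: lM; rewrite dM. Qed.

Variables (cA cM : R).
Hypotheses (cA0 : 0 < cA) (lowA : form_lower dot A cA).
Hypotheses (cM0 : 0 < cM) (lowM : form_lower dot M cM).

Let sA := opsqrt dot HA A.
Let sM := opsqrt dot HM M.
Let SA := opinv sA.
Let SM := opinv sM.
Let B := opinv A.

Let SAlin : linear_on HA SA := invsqrt_linear dotE clA saA cA0 lowA.
Let SAV w : HA w -> HA (SA w). Proof. exact: invsqrtV lowA w. Qed.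
Let SASA w : HA w -> SA (SA w) = B w. Proof. exact: invsqrt_square lowA w. Qed.
Let SAsym x y : HA x -> HA y -> dot (SA x) y = dot x (SA y).
Proof. exact: invsqrt_sym lowA x y. Qed.
Let BV w : HA w -> HA (B w). Proof. exact: pd_invV lowA w. Qed.

Let saMroot : selfadjoint dot HM sM.
Proof. by have [] := opsqrtP dotE clM saM cM0 lowM. Qed.

Let sMP u : HM u -> [/\ opdom sM u, HM (sM u) & sM (sM u) = M u].
Proof.
move=> Vu; have [h1 _ h2] := opsqrt_square dotE clM saM cM0 lowM (domM Vu).
by split=> //; exact: (sa_range saMroot).
Qed.

Let sMlin : linear_on HM sM.
Proof. by move=> a x y /sMP[dx _ _] /sMP[dy _ _]; exact: (sa_linear saMroot). Qed.

(** The equation tested with [v = A^-1/2 w] and [u = M^1/2 u0]. *)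
Lemma weak_sylvester_fixpoint T : bounded_operator HM HA T ->
  weak_sylvester dot HA HM A M F T <->
  forall u, HM u -> T u = SA (F (sM u)) + B (T (M u)).
Proof.
move=> [_ _ TV _].
have GV u : HM u -> HA (SA (F (sM u))) by move=> /sMP[_ h _]; exact/SAV/FV.
have tested w u0 : HA w -> HM u0 ->
    (dot (sA (SA w)) (T (SM (sM u0))) - dot (SA w) (SA (T (sM (sM u0)))) =
     dot (SA w) (F (sM u0))) <->
    dot w (T u0) = dot w (SA (F (sM u0)) + B (T (M u0))).
  move=> Vw Vu; have [du Vsu ssu] := sMP Vu.
  have VTM := TV _ (MV Vu).
  have [_ ->] := invsqrtP dotE clA saA cA0 lowA Vw.
  have e1 : dot (SA w) (SA (T (M u0))) = dot w (B (T (M u0))).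
    by rewrite -SASA// SAsym//; exact: SAV.
  have e2 : dot (SA w) (F (sM u0)) = dot w (SA (F (sM u0))).
    by rewrite SAsym//; exact: FV.
  rewrite (invsqrtK dotE clM saM cM0 lowM du) ssu e1 e2 dotDr.
  split=> [<-|->]; first by rewrite subrK.
  by rewrite addrK.
split=> [weak u Vu|fixed sA' sM' v u dv Vu].
  apply: (dot_ext_in dotE subA); first exact: TV.
    by apply: (subspaceD subA); [exact: GV|exact/BV/TV/MV].
  move=> w Vw; apply/tested => //.
  apply: weak; first by have [] := invsqrtP dotE clA saA cA0 lowA Vw.
  by have [] := sMP Vu.
have VSu : HM (SM u) := invsqrtV dotE clM saM cM0 lowM Vu.
have Vw : HA (sA v) := opsqrtV dotE clA saA cA0 lowA dv.
have := (tested _ _ Vw VSu).2 (congr1 (dot (sA v)) (fixed _ VSu)).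
rewrite (invsqrtK dotE clA saA cA0 lowA dv).
by have [_ ->] := invsqrtP dotE clM saM cM0 lowM Vu.
Qed.

(** Cancelling resolvents in the integrand: with [r] the resolvent of M at u and
    w = A^1/2 v, the integrand times z is the difference of two resolvent terms. *)
Lemma resolvent_identity X d delta delta' t v u : 0 < delta -> 0 < delta' ->
  numerical_gap dot A d delta -> numerical_gap dot M d delta' ->
  linear_on HM X -> (forall u, HM u -> HA (X u)) ->
  (forall u, HM u -> X u = SA (F (sM u)) + B (X (M u))) ->
  opdom sA v -> HM u ->
  (d +i* t) * dot (resolvent A (d +i* t) (F (resolvent M (d +i* t) (sM u)))) (sA v) =
  dot (X (M (resolvent M (d +i* t) u))) v -
  dot (resolvent A (d +i* t) (SA (X (M u)) + F (sM u))) (sA v).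
Proof.
move=> delta0 delta'0 gapA gapM Xlin XV XE dv Vu.
set z := d +i* t; set w := sA v.
have Vw : HA w := opsqrtV dotE clA saA cA0 lowA dv.
have vE : v = SA w by rewrite [SA w](invsqrtK dotE clA saA cA0 lowA dv).
set r := resolvent M z u.
have [dr rE] := resolventP dotE clM saM delta'0 gapM t Vu.
rewrite -/z -/r in dr rE.
have Vr : HM r := sa_dom_sub saM dr.
have VMr := MV Vr.
have sMr : resolvent M z (sM u) = sM r.
  have [dsr Vsr ssr] := sMP Vr; have [_ Vsu _] := sMP Vu.
  have [dq qE] := resolventP dotE clM saM delta'0 gapM t Vsu.
  apply: (gap_injective dotE saM delta'0 gapM dq (domM Vsr) (zeta := t)).
  rewrite -/z in qE *; rewrite qE.
  have [_ _ <-] := sMP Vsr; rewrite ssr -{1}rE.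
  by rewrite (linear_onB sMlin) ?(linear_onZ subM sMlin)//; exact: subspaceZ.
pose w' x := SA (X (M x)) + F (sM x).
have w'V x : HM x -> HA (w' x).
  move=> Vx; have [_ Vsx _] := sMP Vx.
  by apply: (subspaceD subA); [exact/SAV/XV/MV|exact: FV].
have w'lin : linear_on HM w'.
  move=> a x y Vx Vy; have [_ Vsx _] := sMP Vx; have [_ Vsy _] := sMP Vy.
  rewrite /w' Mlin// Xlin; [|exact: MV|exact: MV].
  rewrite SAlin; [|exact/XV/MV|exact/XV/MV].
  rewrite sMlin// Flin//; by rewrite scalerDr addrACA.
have Xw' x : HM x -> X x = SA (w' x).
  move=> Vx; have [_ Vsx _] := sMP Vx.
  rewrite /w' (linear_onD SAlin); [|exact/SAV/XV/MV|exact: FV].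
  by rewrite SASA; [rewrite addrC XE|exact/XV/MV].
set k := F (sM r).
have Vk : HA k by have [_ Vsr _] := sMP Vr; exact: FV.
have w'u : w' u = w' (M r) - z *: w' r.
  by rewrite -rE (linear_onB w'lin) ?(linear_onZ subM w'lin)//; exact: subspaceZ.
pose y := B (w' (M r)).
have [dy yE] := pd_invP dotE clA saA cA0 lowA (w'V _ VMr).
have yX : y = SA (X (M r)) by rewrite Xw'// SASA//; exact: w'V.
have [dk kE] := resolventP dotE clA saA delta0 gapA t Vk.
have [dq qE] := resolventP dotE clA saA delta0 gapA t (w'V _ Vu).
rewrite sMr -/k -/(w' u) -/z in dk kE dq qE *.
have -> : resolvent A z (w' u) = y - z *: resolvent A z k.
  have dzk : opdom A (y - z *: resolvent A z k).
    by apply: (subspaceB (sa_subspace saA)) => //; exact: (subspaceZ (sa_subspace saA)).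
  apply: (gap_injective dotE saA delta0 gapA dq dzk (zeta := t)); rewrite -/z qE.
  rewrite (linear_onB (sa_linear saA))//; last exact: (subspaceZ (sa_subspace saA)).
  rewrite (linear_onZ (sa_subspace saA) (sa_linear saA))// yE w'u.
  rewrite scalerBr -[RHS]addrA -opprD addrCA -scalerBr kE -scalerDr.
  by congr (_ - _ *: _); rewrite /w' -yX.
have -> : dot (X (M r)) v = dot y w by rewrite yX vE SAsym//; exact: XV.
by rewrite dotBl dotZl opprB addrC subrK.
Qed.

End Sylvester.

Theorem theorem2p1 (R : realType) (H : completeNormedModType R[i])
    (dot : {dot H for Num.conj}) (HA HM : set H) (A M F : operator H) :
  hilbert_norm dot ->
  closed_subspace HA -> closed_subspace HM ->
  positive_definite dot HA A -> positive_definite dot HM M ->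
  bounded_operator HM HA F ->
  bounded_operator HM HM M ->
  (opnorm M < (opnorm (opinv A))^-1)%E ->
  exists T : operator H,
    [/\ bounded_operator HM HA T,
        weak_sylvester dot HA HM A M F T,
        (forall T' : operator H, bounded_operator HM HA T' ->
           weak_sylvester dot HA HM A M F T' -> opeq T' T) &
        (forall d : R,
           (opnorm M < d%:E)%E -> (d%:E < (opnorm (opinv A))^-1)%E ->
           forall v u : H, opdom (opsqrt dot HA A) v -> HM u ->
             cintegrable (tau_integrand dot HA HM A M F d v u) /\
             dot v (T u) = tau dot HA HM A M F d v u)].
Proof.
move=> dotE clA clM pdA pdM bF bM ltMA.
have [cA cA0 lowA] := positive_definite_lower pdA.
have [cM cM0 lowM] := positive_definite_lower pdM.
have saA : selfadjoint dot HA A by case: pdA.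
have saM : selfadjoint dot HM M by case: pdM.
have subA : linear_subspace HA by case: clA => _ /submod_subspace.
have subM : linear_subspace HM by case: clM => _ /submod_subspace.
have [m m0 [ME [MV Mlin Mm]]] := bounded_operator_map bM.
have [f f0 [_ FP]] := bounded_operator_map bF.
have [linB domB] : linear_operator (opinv A) /\ opdom (opinv A) = HA.
  have dB : opdom (opinv A) = HA.
    apply/seteqP; split=> [_ [x dx <-]|y Vy]; first exact: (sa_range saA dx).
    by have [dx yE] := pd_invP dotE clA saA cA0 lowA Vy; exists (opinv A y).
  split=> //; split; first by rewrite dB; exact: subspace_submod.
  by rewrite dB; exact: (pd_inv_linear dotE clA saA cA0 lowA).
(* A number between |M| and 1 / |A^-1| separates the forms of M and of A. *)
have separate d : (opnorm M < d%:E)%E -> (d%:E < (opnorm (opinv A))^-1)%E ->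
    exists e, [/\ m < d, d < e, 0 < e,
      bounded_map HA HA (opinv A) e^-1 & form_lower dot A e].
  rewrite ME lte_fin => md dB.
  have d0 : 0 < d by exact: le_lt_trans md.
  have [e de Be] := lt_inve_real (opnorm_ge0 linB) d0 dB.
  have e0 : 0 < e by exact: lt_trans de.
  have Bbound y : HA y -> nrm (opinv A y) <= e^-1 * nrm y.
    by move=> Vy; apply: (opnorm_le linB Be); rewrite domB.
  exists e; split=> //; last exact: (form_lower_inv dotE clA saA cA0 lowA e0 Bbound).
  split=> //; first by move=> y; exact: (pd_invV dotE clA saA cA0 lowA).
  exact: (pd_inv_linear dotE clA saA cA0 lowA).
have linM : linear_operator M by case: bM.
have domM : opdom M = HM by case: bM.
set sA := opsqrt dot HA A; set sM := opsqrt dot HM M.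
have sqM u : HM u -> [/\ opdom sM u, HM (sM u) & sM (sM u) = M u].
  move=> Vu; have du : opdom M u by rewrite domM.
  have [h1 h2 h3] := opsqrt_square dotE clM saM cM0 lowM du.
  by split=> //; exact: (opsqrtV dotE clM saM cM0 lowM).
have saMroot : selfadjoint dot HM sM by have [] := opsqrtP dotE clM saM cM0 lowM.
have sMP : bounded_map HM HM sM (1 + m).
  split=> [u /sqM[]//|a x y /sqM[dx _ _] /sqM[dy _ _]|u Vu].
    exact: (sa_linear saMroot).
  have [du Vsu suE] := sqM _ Vu; have [dsu _ _] := sqM _ Vsu.
  apply: le_of_sqr_le; rewrite ?nrm_ge0//.
  have -> : nrm (sM u) ^+ 2 = complex.Re (dot (M u) u).
    by rewrite -suE (sa_sym saMroot)// (dot_nrm dotE).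
  apply: le_trans (ler_norm _) _; apply: le_trans (Re_dot_le dotE _ _) _.
  by rewrite expr2 mulrA ler_wpM2r ?nrm_ge0// Mm.
have [d1 [Md1 d1B]] := real_between (opnorm_ge0 linM) ltMA.
have [e1 [md1 de1 e10 BP low1]] := separate _ Md1 d1B.
have e1V : 0 <= e1^-1 by rewrite invr_ge0 ltW.
have SAP : bounded_map HA HA (opinv sA) (1 + e1^-1).
  split=> [w|//|w Vw]; first exact: (invsqrtV dotE clA saA cA0 lowA).
    exact: (invsqrt_linear dotE clA saA cA0 lowA).
  apply: le_of_sqr_le; rewrite ?nrm_ge0//.
  rewrite (invsqrt_nrm2 dotE clA saA cA0 lowA Vw).
  apply: le_trans (ler_norm _) _; apply: le_trans (Re_dot_le dotE _ _) _.
  by rewrite expr2 mulrA ler_wpM2r ?nrm_ge0//; case: BP => _ _; apply.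
have GP := bounded_map_comp (addr_ge0 ler01 e1V) SAP (bounded_map_comp f0 FP sMP).
have g0 : 0 <= (1 + e1^-1) * (f * (1 + m)) by rewrite !mulr_ge0 ?addr_ge0.
have em1 : e1^-1 * m < 1 by rewrite mulrC ltr_pdivrMr// mul1r (lt_trans md1).
have MP : bounded_map HM HM M m by [].
have [X [K [K0 XP XE]]] := fixpoint_exists subM clA.1 subA GP BP MP g0 e1V m0 em1.
have Tbounded := map_bounded_operator subM K0 XP.
have weakP := weak_sylvester_fixpoint dotE clA clM pdA pdM bF bM cA0 lowA cM0 lowM.
exists (Operator HM X); split=> //; first exact/weakP.
  move=> T' bT' /(weakP T' bT').1 T'E; have [K' K'0 [_ T'P]] := bounded_operator_map bT'.
  have domT' : opdom T' = HM by case: bT'.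
  split=> // u; rewrite domT' => Vu.
  exact: (fixpoint_unique subM subA BP MP e1V m0 em1 XP T'P XE T'E).
move=> d Md dB v u dv Vu.
have [e [md de e0 _ low]] := separate d Md dB.
have d0 : 0 < d by exact: le_lt_trans md.
have [XV Xlin XK] := XP.
have gapA := form_lower_gap d low.
have gapM : numerical_gap dot M d (d - m).
  move=> x dx; rewrite distrC; apply: le_trans (ler_norm _).
  rewrite mulrBl lerD2l lerN2; apply: le_trans (ler_norm _) _.
  apply: le_trans (Re_dot_le dotE _ _) _.
  by rewrite expr2 mulrA ler_wpM2r ?nrm_ge0// Mm// -domM.
have eA : 0 < e - d by rewrite subr_gt0.
have eM : 0 < d - m by rewrite subr_gt0.
set w := sA v.
have Vw : HA w := opsqrtV dotE clA saA cA0 lowA dv.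
pose x0 := opinv sA (X (M u)) + F (sM u).
have Vx0 : HA x0.
  apply: (subspaceD subA); first by case: SAP => + _ _; apply; exact/XV/MV.
  by case: FP => + _ _; apply; have [] := sqM _ Vu.
have outside : has_cintegral (fun t => dot (X (M (resolvent M (d +i* t) u))) v * line_inv d t) 0.
  apply: (has_cintegral_resolvent_outside dotE clM saM (L := fun x => dot (X x) v)
    (C := K * nrm v) _ _ _ d0 eM gapM _ m0 md _ Vu) => //.
  - by move=> a x y Vx Vy; rewrite Xlin// dotDl dotZl.
  - by rewrite mulr_ge0 ?nrm_ge0.
  - move=> x Vx; apply: le_trans (cauchy_schwarz dotE _ _) _.
    by rewrite mulrAC ler_wpM2r ?nrm_ge0// XK.
  - by move=> x; rewrite domM.
have inside : has_cintegral (fun t => dot (resolvent A (d +i* t) x0) w * line_inv d t)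
    (dot (X u) v * (2 * pi)%:C).
  have -> : dot (X u) v = dot (opinv A x0) w.
    have vE : v = opinv sA w by rewrite (invsqrtK dotE clA saA cA0 lowA dv).
    have Vsx : HA (opinv sA x0) := invsqrtV dotE clA saA cA0 lowA Vx0.
    rewrite -(invsqrt_square dotE clA saA cA0 lowA Vx0).
    rewrite (invsqrt_sym dotE clA saA cA0 lowA Vsx Vw) -/sA -vE; congr (dot _ v).
    have VXM : HA (X (M u)) by exact/XV/MV.
    have VSXM : HA (opinv sA (X (M u))) := invsqrtV dotE clA saA cA0 lowA VXM.
    have VF : HA (F (sM u)) by case: FP => + _ _; apply; have [] := sqM _ Vu.
    rewrite XE// /x0 (linear_onD (invsqrt_linear dotE clA saA cA0 lowA) VSXM VF).
    by rewrite (invsqrt_square dotE clA saA cA0 lowA VXM) addrC.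
  apply: (has_cintegral_resolvent_inside dotE clA saA (L := fun x => dot x w)
    (C := nrm w) _ _ _ d0 eA gapA de low Vx0).
  - by move=> a x y Vx Vy; rewrite dotDl dotZl.
  - exact: nrm_ge0.
  - by move=> x Vx; rewrite mulrC; exact: cauchy_schwarz.
have := has_cintegralJ (has_cintegralD outside (has_cintegralZ (-1) inside)).
rewrite add0r mulN1r => intJ.
have {intJ} [tau_int tauE] : has_cintegral (tau_integrand dot HA HM A M F d v u)
    (- (dot (X u) v * (2 * pi)%:C))^*.
  apply: eq_has_cintegral intJ => t.
  rewrite /tau_integrand -/sA -/sM -/w [RHS]dotC; congr (conjc _).
  have XMlin : linear_on HM X by [].
  have := resolvent_identity dotE clA clM pdA pdM bF bM cA0 lowA cM0 lowM t
    eA eM gapA gapM Xlin XV XE dv Vu.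
  rewrite -/sA -/sM -/w -/x0 => zE.
  rewrite mulN1r -mulrBl -zE mulrAC -[_ * line_inv d t]mulrC.
  by rewrite mulVf ?mul1r// line_neq0// lt0r_neq0.
split=> //; rewrite /tau tauE (dotC dot v) [Operator HM X u]/=.
have pi0 : pi != 0 :> R by rewrite lt0r_neq0// pi_gt0.
case: (dot (X u) v) => a b; move: (@pi R) pi0 => p p0.
apply/eqP; rewrite eq_complex /=.
by apply/andP; split; apply/eqP; field.
Qed.
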